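(* For each $N\in\mathbb{N}$, let $h^N=(t_f-t_0)/N$, $t^N_i=t_0+ih^N$ for $i\in\{0,\dots,N\}$, and let the sets $\Omega^N_i\subseteq\mathbb{R}^n$ ($i\in\{0,\dots,N\}$) and $\Gamma^N_i\subseteq\mathbb{R}^n$ ($i\in\{1,\dots,N\}$) be defined by $\Omega^N_0=X_0$ and, for $i\in\{1,\dots,N\}$ and with $h=h^N$, $$\Omega^N_i=\widetilde{\phi}(t^N_i,t^N_{i-1})\,\Omega^N_{i-1}+h\,B(t^N_i)\,U+\big(\alpha(h)+\theta(h)\|\Omega^N_{i-1}\|\big)\mathbb{B},$$ $$\Gamma^N_i=\operatorname{conv}\Big(\Omega^N_{i-1}\cup\big(\Omega^N_i+(\beta(h)+\gamma(h)\|\Omega^N_{i-1}\|)\mathbb{B}\big)\Big).$$ Denote $\widehat R_N=\bigcup_{i=1}^N\Gamma^N_i$. Then $\mathcal{R}([t_0,t_f])\subseteq\widehat R_N$ for all $N\in\mathbb{N}$, and $d_H(\mathcal{R}([t_0,t_f]),\widehat R_N)=O(1/N)$ as $N\to\infty$.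
   Context: Notation. $\mathbb{N}=\{1,2,\dots\}$, $\mathbb{R}_+=[0,\infty)$. Fix a norm $\|\cdot\|$ on $\mathbb{R}^n$ and a norm $\|\cdot\|$ on $\mathbb{R}^m$; matrices carry the induced operator norms. $\mathbb{B}\subseteq\mathbb{R}^n$ is the closed unit ball; $\|M\|=\sup_{x\in M}\|x\|$ for a nonempty set $M$; sums, scalar multiples and matrix images of sets are pointwise (Minkowski); $\operatorname{conv}$ is the convex hull. The Hausdorff distance of nonempty bounded sets is $d_H(\Omega,\Gamma)=\inf\{\varepsilon>0:\Omega\subseteq\Gamma+\varepsilon\mathbb{B},\ \Gamma\subseteq\Omega+\varepsilon\mathbb{B}\}$. System and standing assumptions. $n,m\in\mathbb{N}$, $t_0<t_f$ real. $X_0\subseteq\mathbb{R}^n$ and $U\subseteq\mathbb{R}^m$ are nonempty, compact and convex. $A:[t_0,t_f]\to\mathbb{R}^{n\times n}$ and $B:[t_0,t_f]\to\mathbb{R}^{n\times m}$ are of class $C^1$, and $\|A(t)\|\le M_A$, $\|\dot A(t)\|\le M_{\dot A}$, $\|B(t)\|\le M_B$, $\|\dot B(t)\|\le M_{\dot B}$ for all $t\in[t_0,t_f]$, with real constants and $M_A>0$. The system is $\dot x(t)=A(t)x(t)+B(t)u(t)$. For $s\in[t_0,t_f]$, $p\in\mathbb{R}^n$ and integrable $u$, $\varphi(\cdot,s,p,u)$ is its unique absolutely continuous solution on $[t_0,t_f]$ (the equation holding for almost every $t$) with value $p$ at time $s$; $\phi(t,s)\in\mathbb{R}^{n\times n}$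 is the transition matrix, $\phi(t,s)p=\varphi(t,s,p,0)$. Let $D=\{(t,s)\in[t_0,t_f]^2: t\ge s\}$. There are given a map $\widetilde\phi:D\to\mathbb{R}^{n\times n}$ and a monotonically increasing $\theta:\mathbb{R}_+\to\mathbb{R}_+$ with $\|\phi(t,s)-\widetilde\phi(t,s)\|\le\theta(t-s)$ for all $(t,s)\in D$ and $\theta(h)=O(h^2)$ as $h\to0$. Reachable sets and tubes. $\mathcal{R}(t)=\{\varphi(t,t_0,x_0,u): x_0\in X_0,\ u:[t_0,t]\to U\text{ measurable}\}$ and $\mathcal{R}([a,b])=\bigcup_{s\in[a,b]}\mathcal{R}(s)$ for $t_0\le a\le b\le t_f$. Auxiliary functions on $\mathbb{R}_+$: $r(s)=\exp(sM_A)-1-sM_A$, $\ \alpha(s)=r(s)\|U\|\dfrac{M_{\dot B}+M_AM_B}{M_A^2}$, $\ \beta(s)=s^2M_{\dot B}\|U\|$, $\ \gamma(s)=r(s)\Big(1+\dfrac{M_{\dot A}}{M_A^2}\Big)$. *)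

(* Defs.v *)
From HB Require Import structures.
From mathcomp Require Import all_boot all_order all_algebra.
From mathcomp Require Import all_classical all_reals all_analysis.
From mathcomp Require Import measurable_realfun.

Set Implicit Arguments.
Unset Strict Implicit.
Unset Printing Implicit Defensive.

Import Order.TTheory GRing.Theory Num.Theory.
Import numFieldNormedType.Exports.

Local Open Scope classical_set_scope.
Local Open Scope ring_scope.

(* An arbitrary norm on R^k is an explicit function N : 'cV[R]_k -> R.  Topology
   (compactness, derivatives, continuity, absolute continuity, Borel sets) is
   taken from the canonical sup norm of 'M[R]_(p, q), which is equivalent to
   every other norm; all quantitative notions below use the given norms.
   Functions on a real interval are total functions on R whose values outside
   of the interval are never used. *)

Definition is_norm (R : realType) (k : nat) (N : 'cV[R]_k -> R) : Prop :=
  [/\ forall x y, N (x + y) <= N x + N y,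
      forall (a : R) x, N (a *: x) = `|a| * N x
    & forall x, N x = 0 -> x = 0].

Definition unit_ball (R : realType) (k : nat) (N : 'cV[R]_k -> R) :
  set 'cV[R]_k := [set x | N x <= 1].

(* [sup] is the real supremum, 0 on unbounded sets; in finite dimension the
   set is bounded, and it contains 0. *)
Definition opnorm (R : realType) (p q : nat) (Nq : 'cV[R]_q -> R)
    (Np : 'cV[R]_p -> R) (M : 'M[R]_(p, q)) : R :=
  sup [set Np (M *m x) | x in unit_ball Nq].

(* ||S||; to be used for nonempty bounded S only (see [sup] above). *)
Definition set_norm (R : realType) (k : nat) (N : 'cV[R]_k -> R)
    (S : set 'cV[R]_k) : R := sup [set N x | x in S].

Definition set_add (R : realType) (k : nat) (S T : set 'cV[R]_k) :
  set 'cV[R]_k := [set x + y | x in S & y in T].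

Definition set_scale (R : realType) (k : nat) (a : R) (S : set 'cV[R]_k) :
  set 'cV[R]_k := [set a *: x | x in S].

Definition set_mulmx (R : realType) (p q : nat) (M : 'M[R]_(p, q))
  (S : set 'cV[R]_q) : set 'cV[R]_p := [set M *m x | x in S].

Definition conv_hull (R : realType) (k : nat) (S : set 'cV[R]_k) :
  set 'cV[R]_k := smallest (@convex_set R 'cV[R]_k) S.

(* For nonempty bounded S and T the set of admissible e is nonempty, so that
   the real [inf] is the actual infimum. *)
Definition hausdorff (R : realType) (k : nat) (N : 'cV[R]_k -> R)
    (S T : set 'cV[R]_k) : R :=
  inf [set e | [/\ 0 < e, S `<=` set_add T (set_scale e (unit_ball N))
                        & T `<=` set_add S (set_scale e (unit_ball N))]].

(* Derivatives relative to a subset of R: one-sided at the endpoints of an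
   interval, hence independent of the values outside of it. *)
Definition diff_quotient (R : realType) (V : normedModType R) (f : R -> V)
  (t : R) : R -> V := fun s => (s - t)^-1 *: (f s - f t).

Definition derive_within (R : realType) (V : normedModType R) (S : set R)
  (f : R -> V) (t : R) : V := lim (diff_quotient f t @ within S t^').

Definition C1_on (R : realType) (V : normedModType R) (a b : R) (f : R -> V) :
    Prop :=
  (forall t, t \in `[a, b] ->
     cvg (diff_quotient f t @ within `[a, b]%classic t^')) /\
  {within `[a, b], continuous (derive_within `[a, b]%classic f)}.

Definition abs_continuous (R : realType) (V : normedModType R) (a b : R)
    (x : R -> V) : Prop :=
  forall e : R, 0 < e -> exists2 d : R, 0 < d &
    forall (k : nat) (l r : 'I_k -> R),
      (forall i, [/\ a <= l i, l i <= r i & r i <= b]) ->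
      trivIset [set: 'I_k] (fun i => `]l i, r i[%classic) ->
      \sum_(i < k) (r i - l i) < d ->
      \sum_(i < k) `|x (r i) - x (l i)| < e.

(* Measurability with respect to the Lebesgue sigma-algebra (the completion of
   the Borel one) on the source and the Borel sigma-algebra on the target. *)
Definition lebesgue_measurable_fun (R : realType) (k : nat) (D : set R)
    (u : R -> 'cV[R]_k) : Prop :=
  @measurable_fun _ _
    (g_sigma_algebraType (completed_algebra_gen (@lebesgue_measure R)))
    (g_sigma_algebraType (@open 'cV[R]_k)) D u.

(* x is the absolutely continuous solution on [a, b] of x' = A x + B u that
   takes the value p at time s. The endpoints of [a, b], where the two-sided
   derivative depends on values outside, form a null set. *)
Definition is_solution (R : realType) (n m : nat) (A : R -> 'M[R]_n)
    (B : R -> 'M[R]_(n, m)) (a b s : R) (p : 'cV[R]_n) (u : R -> 'cV[R]_m)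
    (x : R -> 'cV[R]_n) : Prop :=
  [/\ abs_continuous a b x,
      {ae lebesgue_measure, forall t : R, t \in `[a, b] ->
         is_derive (t : R^o) (1 : R^o) x (A t *m x t + B t *m u t)}
    & x s = p].

(* phi t s is the matrix of p |-> value at t of the solution of the
   uncontrolled system starting from p at time s. *)
Definition is_transition_matrix (R : realType) (n m : nat) (A : R -> 'M[R]_n)
    (B : R -> 'M[R]_(n, m)) (t0 tf : R) (phi : R -> R -> 'M[R]_n) : Prop :=
  forall (s : R) (p : 'cV[R]_n), s \in `[t0, tf] ->
    is_solution A B t0 tf s p (fun=> 0) (fun t => phi t s *m p).

Definition reach (R : realType) (n m : nat) (A : R -> 'M[R]_n)
    (B : R -> 'M[R]_(n, m)) (X0 : set 'cV[R]_n) (U : set 'cV[R]_m) (t0 t : R) :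
    set 'cV[R]_n :=
  [set y | exists x0 u x,
     [/\ X0 x0,
         lebesgue_measurable_fun `[t0, t] u,
         forall s, s \in `[t0, t] -> U (u s),
         is_solution A B t0 t t0 x0 u x
       & y = x t]].

Definition reach_tube (R : realType) (n m : nat) (A : R -> 'M[R]_n)
    (B : R -> 'M[R]_(n, m)) (X0 : set 'cV[R]_n) (U : set 'cV[R]_m)
    (t0 a b : R) : set 'cV[R]_n :=
  \bigcup_(s in `[a, b]) reach A B X0 U t0 s.

Definition rfun (R : realType) (MA s : R) : R := expR (s * MA) - 1 - s * MA.

Definition alpha (R : realType) (normU MA MB MdB s : R) : R :=
  rfun MA s * normU * ((MdB + MA * MB) / MA ^+ 2).

Definition beta (R : realType) (normU MdB s : R) : R := s ^+ 2 * MdB * normU.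

Definition gamma (R : realType) (MA MdA s : R) : R :=
  rfun MA s * (1 + MdA / MA ^+ 2).

Definition step (R : realType) (t0 tf : R) (N : nat) : R := (tf - t0) / N%:R.

Definition node (R : realType) (t0 tf : R) (N i : nat) : R :=
  t0 + i%:R * step t0 tf N.

Fixpoint Omega (R : realType) (n m : nat) (normX : 'cV[R]_n -> R)
    (normU : 'cV[R]_m -> R) (t0 tf : R) (B : R -> 'M[R]_(n, m))
    (X0 : set 'cV[R]_n) (U : set 'cV[R]_m) (MA MB MdB : R)
    (phit : R -> R -> 'M[R]_n) (theta : R -> R) (N i : nat) : set 'cV[R]_n :=
  if i is j.+1 then
    let Om := Omega normX normU t0 tf B X0 U MA MB MdB phit theta N j in
    let h := step t0 tf N in
    let t := node t0 tf N in
    set_add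
      (set_add (set_mulmx (phit (t j.+1) (t j)) Om)
               (set_scale h (set_mulmx (B (t j.+1)) U)))
      (set_scale (alpha (set_norm normU U) MA MB MdB h
                  + theta h * set_norm normX Om) (unit_ball normX))
  else X0.

(* Only used for 1 <= i <= N. *)
Definition Gamma (R : realType) (n m : nat) (normX : 'cV[R]_n -> R)
    (normU : 'cV[R]_m -> R) (t0 tf : R) (B : R -> 'M[R]_(n, m))
    (X0 : set 'cV[R]_n) (U : set 'cV[R]_m) (MA MdA MB MdB : R)
    (phit : R -> R -> 'M[R]_n) (theta : R -> R) (N i : nat) : set 'cV[R]_n :=
  let Om := Omega normX normU t0 tf B X0 U MA MB MdB phit theta N in
  let h := step t0 tf N in
  conv_hull
    (Om i.-1 `|`
     set_add (Om i)
       (set_scale (beta (set_norm normU U) MdB h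
                   + gamma MA MdA h * set_norm normX (Om i.-1))
                  (unit_ball normX))).

Definition Rhat (R : realType) (n m : nat) (normX : 'cV[R]_n -> R)
    (normU : 'cV[R]_m -> R) (t0 tf : R) (B : R -> 'M[R]_(n, m))
    (X0 : set 'cV[R]_n) (U : set 'cV[R]_m) (MA MdA MB MdB : R)
    (phit : R -> R -> 'M[R]_n) (theta : R -> R) (N : nat) : set 'cV[R]_n :=
  \bigcup_(i in [set i : nat | (1 <= i <= N)%N])
    Gamma normX normU t0 tf B X0 U MA MdA MB MdB phit theta N i.

(* Main.v *)
Require Import Defs.
From HB Require Import structures.
From mathcomp Require Import all_boot all_order all_algebra.
From mathcomp Require Import all_classical all_reals all_analysis.
From mathcomp Require Import measurable_realfun ring lra.

Set Implicit Arguments.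
Unset Strict Implicit.
Unset Printing Implicit Defensive.

Import Order.TTheory GRing.Theory Num.Theory.
Import numFieldNormedType.Exports.

Local Open Scope classical_set_scope.
Local Open Scope ring_scope.

(** The proof rests on a mean value inclusion for absolutely continuous functions
    ([increment_hull]): if almost everywhere the derivative of [f] lies within
    [g'] of a compact convex set [K], then the increment [f b - f a] lies within
    [g b - g a] of [(b - a) K].

    Over-approximation.  During a step of length [h] starting at the node [t_i],
    a trajectory [x] is the free motion [phi(t, t_i) x(t_i)] plus a term [w] with
    [w' = A w + B u] and [w(t_i) = 0].  Gronwall's inequality makes [w] of first
    order, hence [w'] is close to [B(t_{i+1}) U] and the mean value inclusion
    replaces the control by a constant one with an error [alpha]
    ([control_step]).  At the end of the step this produces a point of
    [Omega_{i+1}] ([trajectory_node]).  At the intermediate time [t_i + l h] the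
    free motion is within [l gamma] of its chord ([phi_chord]), so that [x] is the
    convex combination with weights [1 - l] and [l] of a point of [Omega_i] and of
    a point of the inflated set [Omega_{i+1}] ([trajectory_Gamma]).

    Rate.  Since [alpha] and [theta] are [O(h^2)], one step multiplies the radius of
    [Omega_i] by [1 + O(h)] and adds [O(h)], so that the radii stay bounded
    ([Omega_uniform]).  A point of [Omega_i] is built with one control
    value per step; the exact trajectory driven by these values deviates from it
    by [O(h^2)] more at each step, hence by [O(h)] in total
    ([Omega_tracking]).  That trajectory is given on each step by variation
    of constants ([constant_control_solution]).  Finally [Gamma_{i+1}] lies within
    [O(h)] of [Omega_i], because the points that close to the convex set [Omega_i]
    form a convex set which contains the generators of the hull
    ([Gamma_near_Omega]). *)

(** * Norms on column vectors *)

Lemma cont_of_lip (R : realType) (V W : normedModType R) (f : V -> W) (C : R) :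
  (forall x y, `|f x - f y| <= C * `|x - y|) -> continuous f.
Proof.
move=> hf x; apply/cvgrPdist_le => /= e e0; apply/nbhs_ballP.
have C0 : 0 < `|C| + 1 by rewrite ltr_wpDl.
exists (e / (`|C| + 1)) => /=; first exact: divr_gt0.
move=> y; rewrite -ball_normE /ball_/= ltr_pdivlMr// => xy.
apply: (le_trans (hf _ _)); apply/ltW; apply: le_lt_trans xy.
rewrite mulrC ler_wpM2l//; have := ler_norm C; lra.
Qed.

Section norm_theory.
Context {R : realType} {k : nat} (N : 'cV[R]_k -> R) (hN : is_norm N).

Lemma nrmD x y : N (x + y) <= N x + N y. Proof. by case: hN. Qed.
Lemma nrmZ (a : R) x : N (a *: x) = `|a| * N x. Proof. by case: hN. Qed.
Lemma nrm0_eq0 x : N x = 0 -> x = 0. Proof. by case: hN => _ _; apply. Qed.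

Lemma nrm0 : N 0 = 0. Proof. by rewrite -(scale0r 0) nrmZ normr0 mul0r. Qed.

Lemma nrmN x : N (- x) = N x.
Proof. by rewrite -scaleN1r nrmZ normrN normr1 mul1r. Qed.

Lemma nrm_ge0 x : 0 <= N x.
Proof.
have := nrmD x (- x); rewrite subrr nrm0 nrmN => ?; lra.
Qed.

Lemma nrmC x y : N (x - y) = N (y - x).
Proof. by rewrite -nrmN opprB. Qed.

Lemma nrmZp (a : R) x : 0 <= a -> N (a *: x) = a * N x.
Proof. by move=> a0; rewrite nrmZ ger0_norm. Qed.

Lemma nrmB x y : N (x - y) <= N x + N y.
Proof. by rewrite -(nrmN y) nrmD. Qed.

Lemma nrm_tri y x z : N (x - z) <= N (x - y) + N (y - z).
Proof. by rewrite -{1}(subrK y x) -addrA nrmD. Qed.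

Lemma nrm_rev x y : N x <= N (x - y) + N y.
Proof. by rewrite -{1}(subrK y x) nrmD. Qed.

Lemma nrm_sum (I : finType) (F : I -> 'cV[R]_k) :
  N (\sum_i F i) <= \sum_i N (F i).
Proof.
apply: (big_ind2 (fun a b => N a <= b)) => //; first by rewrite nrm0.
by move=> a b c d ab cd; apply: (le_trans (nrmD _ _)); exact: lerD.
Qed.

Lemma abs_entry_le (x : 'cV[R]_k) i : `|x i 0| <= `|x|.
Proof.
rewrite [leRHS]/Num.Def.normr/= mx_normrE.
exact: (le_bigmax _ _ (i, 0)).
Qed.

(** Expansion in the canonical basis. *)
Lemma nrm_le_sup : exists2 C, 0 < C & forall x, N x <= C * `|x|.
Proof.
exists (1 + \sum_i N (delta_mx i 0)).
  by rewrite ltr_pwDl// sumr_ge0// => i _; exact: nrm_ge0.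
move=> x; rewrite {1}(matrix_sum_delta x).
apply: (le_trans (nrm_sum _)).
rewrite mulrDl mul1r ler_wpDl// mulr_suml; apply: ler_sum => i _.
by rewrite big_ord1 nrmZ mulrC ler_wpM2l ?nrm_ge0 ?abs_entry_le.
Qed.

Lemma nrm_dist x y : `|N x - N y| <= N (x - y).
Proof.
rewrite ler_norml; apply/andP; split.
  by have := nrm_rev y x; rewrite nrmC => ?; lra.
by have := nrm_rev x y => ?; lra.
Qed.

Lemma nrm_cont : continuous N.
Proof.
have [C C0 hC] := nrm_le_sup.
apply: (@cont_of_lip _ 'cV[R]_k R^o _ C) => x y.
by apply: le_trans (hC _); exact: nrm_dist.
Qed.

End norm_theory.

Section norm_equivalence.
Context {R : realType} {k : nat} (N : 'cV[R]_k -> R) (hN : is_norm N).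

Lemma trmx_mx_norm m n (x : 'M[R]_(m, n)) : `|x^T| = `|x|.
Proof.
have h p q (y : 'M[R]_(p, q)) : `|y^T| <= `|y|.
  rewrite [leLHS]/Num.Def.normr/= mx_normrE; apply: bigmax_le => //= -[i j] _.
  rewrite mxE [leRHS]/Num.Def.normr/= mx_normrE.
  exact: (le_bigmax _ _ (j, i)).
by apply/le_anti; rewrite h/= -{1}(trmxK x) h.
Qed.

Lemma trmx_continuous m n : continuous (@trmx R m n).
Proof.
by apply: (@cont_of_lip _ _ _ _ 1) => x y; rewrite -linearB/= trmx_mx_norm mul1r.
Qed.

(** The sup-norm unit sphere is compact, so the continuous function [N] has a
    positive minimum on it. *)
Lemma sup_le_nrm : exists2 c, 0 < c & forall x, `|x| <= c * N x.
Proof.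
pose S := [set x : 'rV[R]_k | `|x| = 1].
have cS : compact S.
  apply: bounded_closed_compact.
    by exists 1; split => // M M1 x/= ->; exact: ltW.
  have -> : S = (fun x => `|x|) @^-1` [set 1] by [].
  apply: closed_comp => [x _|]; first exact: norm_continuous.
  exact: closed_eq.
have [[x0 Sx0]|S0] := pselect (S !=set0); last first.
  exists 1 => // x; rewrite mul1r; have [->|x0] := eqVneq x 0.
    by rewrite normr0 (nrm_ge0 hN).
  exfalso; apply: S0; exists (`|x|^-1 *: x^T).
  by rewrite /S/= normrZ trmx_mx_norm normfV normr_id mulVf// normr_eq0.
have [||c] := @compact_EVT_min _ _ (N \o trmx) S _ cS; first by exists x0.
  apply: continuous_subspaceT => x; apply: continuous_comp.
    exact: trmx_continuous.
  exact: (nrm_cont hN).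
rewrite inE => cS1 /= hc.
have Nc0 : 0 < N c^T.
  rewrite lt_neqAle (nrm_ge0 hN) andbT eq_sym; apply/eqP => /(nrm0_eq0 hN).
  move/(congr1 (fun x => `|x|)); rewrite trmx_mx_norm normr0 cS1 => /eqP.
  by rewrite oner_eq0.
exists (N c^T)^-1; first by rewrite invr_gt0.
move=> x; have [->|x0'] := eqVneq x 0.
  by rewrite normr0 mulr_ge0 ?invr_ge0 ?(nrm_ge0 hN)// ltW.
rewrite mulrC ler_pdivlMr// mulrC -ler_pdivlMr ?normr_gt0// mulrC.
rewrite -[leRHS](nrmZp hN) ?invr_ge0// -[_ *: x]trmxK; apply: hc.
by rewrite inE /S/= trmx_mx_norm normrZ normfV normr_id mulVf// normr_eq0.
Qed.

End norm_equivalence.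

Section operator_norm.
Context {R : realType} {p q : nat} (Np : 'cV[R]_p -> R) (Nq : 'cV[R]_q -> R).
Hypotheses (hp : is_norm Np) (hq : is_norm Nq).

Lemma mulmx_sup_le (M : 'M[R]_(p, q)) (x : 'cV[R]_q) :
  `|M *m x| <= q%:R * `|M| * `|x|.
Proof.
rewrite [leLHS]/Num.Def.normr/= mx_normrE; apply: bigmax_le => /=.
  by rewrite !mulr_ge0.
move=> [i j] _ /=; rewrite mxE; apply: (le_trans (ler_norm_sum _ _ _)).
have -> : q%:R * `|M| * `|x| = \sum_(l < q) `|M| * `|x|.
  by rewrite sumr_const card_ord -mulrA mulr_natl.
apply: ler_sum => l _; rewrite normrM ler_pM//.
  by rewrite [leRHS]/Num.Def.normr/= mx_normrE (le_bigmax _ _ (i, l)).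
by rewrite (ord1 j) abs_entry_le.
Qed.

(** Equivalence of norms bounds the set whose supremum is the operator norm; a
    supremum of an unbounded set would be 0 and [opnorm_le] would fail. *)
Lemma opnorm_has_sup (M : 'M[R]_(p, q)) :
  has_sup [set Np (M *m x) | x in unit_ball Nq].
Proof.
have [C C0 hC] := nrm_le_sup hp.
have [c c0 hc] := sup_le_nrm hq.
split; first by exists (Np (M *m 0)), 0 => //; rewrite /unit_ball/= (nrm0 hq).
exists (C * (q%:R * `|M| * c)) => _ [y /= yB <-].
apply: (le_trans (hC _)); rewrite ler_wpM2l ?(ltW C0)//.
apply: (le_trans (mulmx_sup_le _ _)); rewrite ler_wpM2l ?mulr_ge0//.
by apply: (le_trans (hc _)); rewrite ger_pMr.
Qed.

Lemma opnorm_le (M : 'M[R]_(p, q)) x : Np (M *m x) <= opnorm Nq Np M * Nq x.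
Proof.
have [->|x0] := eqVneq x 0.
  by rewrite mulmx0 (nrm0 hp) (nrm0 hq) mulr0.
have Nx0 : 0 < Nq x.
  rewrite lt_neqAle (nrm_ge0 hq) andbT eq_sym; apply: contra_neq x0.
  exact: nrm0_eq0.
rewrite -ler_pdivrMr// mulrC -(nrmZp hp) ?invr_ge0 ?(ltW Nx0)// scalemxAr.
apply: (ub_le_sup (opnorm_has_sup _).2); exists ((Nq x)^-1 *: x) => //.
by rewrite /unit_ball/= (nrmZp hq) ?invr_ge0 ?(ltW Nx0)// mulVf// gt_eqF.
Qed.

Lemma opnorm_bound (M : 'M[R]_(p, q)) C x :
  opnorm Nq Np M <= C -> Np (M *m x) <= C * Nq x.
Proof.
by move=> h; apply: (le_trans (opnorm_le _ _)); rewrite ler_wpM2r ?(nrm_ge0 hq).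
Qed.

Lemma opnorm_ge0 (M : 'M[R]_(p, q)) : 0 <= opnorm Nq Np M.
Proof.
apply: (ub_le_sup (opnorm_has_sup _).2); exists 0.
  by rewrite /unit_ball/= (nrm0 hq).
by rewrite mulmx0 (nrm0 hp).
Qed.

End operator_norm.

(** * Convex sets, balls and hulls *)

(** Convexity with real weights; [convexP] relates it to [convex_set], whose
    weights have a bundled type. *)
Definition convexS (R : realType) (V : lmodType R) (K : set V) : Prop :=
  forall x y (a : R), 0 <= a -> a <= 1 -> K x -> K y ->
    K (a *: x + (1 - a) *: y).

Section sets_and_norms.
Context {R : realType} {k : nat} (N : 'cV[R]_k -> R) (hN : is_norm N).
Implicit Types S K : set 'cV[R]_k.

Definition bounded_by (S : set 'cV[R]_k) (M : R) := forall x, S x -> N x <= M.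

Lemma compact_bounded_by K : compact K -> exists M, bounded_by K M.
Proof.
have [C C0 hC] := nrm_le_sup hN.
move=> cK; have [M [_ hM]] := compact_bounded cK; exists (C * (M + 1)) => v Kv.
apply: (le_trans (hC _)); rewrite ler_wpM2l ?(ltW C0)//.
by apply: hM Kv; rewrite ltrDl.
Qed.

Lemma set_norm_ub S M x : bounded_by S M -> S x -> N x <= set_norm N S.
Proof.
move=> hM Sx; apply: ub_le_sup; last by exists x.
by exists M => _ [y /hM yM <-].
Qed.

Lemma set_norm_le S M : S !=set0 -> bounded_by S M -> set_norm N S <= M.
Proof.
move=> [x Sx] hM; apply: ge_sup; first by exists (N x), x.
by move=> _ [y /hM yM <-].
Qed.

Lemma set_norm_ge0 S : 0 <= set_norm N S.
Proof.
have [[[_ [x Sx _]] ub]|ns] := pselect (has_sup [set N x | x in S]).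
  apply: (le_trans (nrm_ge0 hN x)); apply: ub_le_sup ub _ _.
  by exists x.
by rewrite /set_norm sup_out.
Qed.

Lemma scale_ballP r z : 0 <= r ->
  set_scale r (unit_ball N) z <-> N z <= r.
Proof.
move=> r0; split=> [[b bB <-]|zr].
  by rewrite (nrmZp hN)// -[leRHS]mulr1 ler_wpM2l.
move: r0; rewrite le_eqVlt => /orP[/eqP r0|r0].
  exists 0; first by rewrite /unit_ball/= (nrm0 hN).
  rewrite scaler0; apply/esym/(nrm0_eq0 hN)/le_anti.
  by rewrite (nrm_ge0 hN) -r0 in zr *; rewrite zr.
exists (r^-1 *: z); last by rewrite scalerA divff ?scale1r// gt_eqF.
by rewrite /unit_ball/= (nrmZp hN) ?invr_ge0 ?(ltW r0)// mulrC ler_pdivrMr// mul1r.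
Qed.

(** Splits a total error proportionally, such as the one of [trajectory_Gamma]
    between the radii of [Omega] and of [Gamma]. *)
Lemma nrm_split a b z : 0 <= a -> 0 <= b -> N z <= a + b ->
  exists z1 z2, [/\ z = z1 + z2, N z1 <= a & N z2 <= b].
Proof.
move=> a0 b0 zab; have [ab0|ab0] := eqVneq (a + b) 0.
  exists 0, 0; rewrite (nrm0 hN) a0 b0 addr0; split => //.
  by apply/(nrm0_eq0 hN)/le_anti; rewrite (nrm_ge0 hN) -ab0 zab.
have ab1 : 0 < a + b by rewrite lt_neqAle eq_sym ab0 addr_ge0.
exists ((a / (a + b)) *: z), ((b / (a + b)) *: z); split.
- by rewrite -scalerDl -mulrDl divff// scale1r.
- by rewrite (nrmZp hN) ?divr_ge0 ?(ltW ab1)// mulrAC ler_pdivrMr// ler_wpM2l.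
- by rewrite (nrmZp hN) ?divr_ge0 ?(ltW ab1)// mulrAC ler_pdivrMr// ler_wpM2l.
Qed.

Lemma convexP (V : lmodType R) (K : set V) :
  @convex_set R V K <-> convexS K.
Proof.
split.
  move=> cK x y a a0 a1 Kx Ky.
  by have := cK x y (Itv01 a0 a1); rewrite !inE; apply.
by move=> cK x y l; rewrite !inE => Kx Ky; apply: cK.
Qed.

Lemma conv_hull_segment S x y (a : R) : 0 <= a -> a <= 1 -> S x -> S y ->
  conv_hull S (a *: x + (1 - a) *: y).
Proof.
move=> a0 a1 Sx Sy T [/convexP cT ST]; apply: cT => //; exact: ST.
Qed.

Lemma conv_hull_min S K : convexS K -> S `<=` K -> conv_hull S `<=` K.
Proof. by move=> /convexP cK SK; exact: smallest_sub. Qed.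

End sets_and_norms.

(** * Increments of absolutely continuous functions *)

(** First order expansion, convenient for increments on both sides of [t]. *)
Lemma is_derive_eps (R : realType) (V : normedModType R) (f : R -> V) t D :
  is_derive (t : R^o) (1 : R^o) f D <->
  forall e, 0 < e -> exists2 d, 0 < d &
    forall s, `|s - t| < d -> `|f s - f t - (s - t) *: D| <= e * `|s - t|.
Proof.
split.
  case=> fD Dval e e0.
  have : (fun h : R^o => h^-1 *: (f (h *: 1 + t) - f t)) @ 0^' --> D.
    by rewrite -Dval; exact: fD.
  move/cvgrPdist_le => /(_ _ e0); rewrite near_withinE => /nbhs_ballP[d /= d0 hd].
  exists d => // s sd; have [->|st] := eqVneq s t.
    by rewrite !subrr scale0r subr0 !normr0 mulr0.
  have st0 : s - t != 0 by rewrite subr_eq0.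
  have := hd (s - t); rewrite -ball_normE /ball_/= sub0r normrN => /(_ sd st0).
  rewrite -[_ *: 1]/(_ * 1) mulr1 subrK => h.
  have -> : f s - f t - (s - t) *: D =
      - ((s - t) *: (D - (s - t)^-1 *: (f s - f t))).
    by rewrite scalerBr scalerA divff// scale1r opprB.
  by rewrite normrN normrZ mulrC ler_wpM2r.
move=> h.
have cD : (fun h : R^o => h^-1 *: (f (h *: 1 + t) - f t)) @ 0^' --> D.
  apply/cvgrPdist_le => e e0; rewrite near_withinE; apply/nbhs_ballP.
  have [d d0 hd] := h _ e0; exists d => // s; rewrite -ball_normE /ball_/=.
  rewrite sub0r normrN => sd s0; have := hd (s + t); rewrite addrK => /(_ sd).
  rewrite -[_ *: 1]/(_ * 1) mulr1 => h1.
  have -> : D - s^-1 *: (f (s + t) - f t) =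
      - (s^-1 *: (f (s + t) - f t - s *: D)).
    by rewrite [in RHS]scalerBr scalerA mulVf// scale1r opprB.
  by rewrite normrN normrZ normfV mulrC ler_pdivrMr// normr_gt0.
split; first by apply/cvg_ex; exists D.
exact: (cvg_lim _ cD).
Qed.

(** Let [c] be the supremum of all [t] with [P a t]: a small interval ending at [c]
    gives [P a c], and another one leads beyond [c] unless [c] is [b]. *)
Lemma cousin (R : realType) (P : R -> R -> Prop) (a b : R) : a <= b ->
  (forall r s t, a <= r -> r <= s -> s <= t -> t <= b ->
     P r s -> P s t -> P r t) ->
  (forall t, a <= t -> t <= b -> exists2 d, 0 < d &
     forall r s, a <= r -> r <= t -> t <= s -> s <= b ->
       t - d < r -> s < t + d -> P r s) ->
  P a b.
Proof.
move=> ab Padd Ploc.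
pose S := [set t | [/\ a <= t, t <= b & P a t]].
have Sa : S a.
  have [d d0 hd] := Ploc a (lexx _) ab.
  by split => //; apply: hd => //; rewrite ?ltrBlDr ltrDl.
have Sub : ubound S b by move=> t [].
have hS : has_sup S by split; [exists a|exists b].
pose c := sup S.
have ac : a <= c by exact: (ub_le_sup hS.2).
have cb : c <= b by apply: ge_sup => //; exists a.
have [d d0 hd] := Ploc c ac cb.
have [r [ar rb Par] cr] := sup_adherent d0 hS.
have rc : r <= c by exact: (ub_le_sup hS.2).
have Pac : P a c.
  apply: (Padd a r c) => //; apply: hd => //; by rewrite ltrDl.
have [cb'|bc] := ltP c b; last by have <- : c = b by apply/le_anti/andP.
pose s := Num.min b (c + d / 2).
have cs : c < s by rewrite lt_min cb'/= ltrDl divr_gt0.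
have sb : s <= b by rewrite ge_min lexx.
have : S s.
  split => //; first exact: (le_trans ac (ltW cs)).
  apply: (Padd a c s) => //; first exact: ltW.
  apply: hd => //; [exact: ltW|by rewrite ltrBlDr ltrDl|].
  apply: (@le_lt_trans _ _ (c + d / 2)); first by rewrite ge_min lexx orbT.
  lra.
by move/(ub_le_sup hS.2); rewrite leNgt cs.
Qed.

Section interval_lists.
Context {R : realType}.
Implicit Types l : seq (R * R).

(** Finite families of non-overlapping intervals, ordered so that families on
    adjacent segments can be concatenated; they hold the places where an absolutely
    continuous function is not controlled by its derivative. *)
Definition interval_list (O : set R) (r s : R) l : Prop :=
  pairwise (fun p q : R * R => p.2 <= q.1) l /\
  forall p, p \in l ->
    [/\ r <= p.1, p.1 <= p.2, p.2 <= s & `]p.1, p.2[ `<=` O].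

Lemma interval_list_cat (O : set R) (r s t : R) l1 l2 : r <= s -> s <= t ->
  interval_list O r s l1 -> interval_list O s t l2 ->
  interval_list O r t (l1 ++ l2).
Proof.
move=> rs st [p1 i1] [p2 i2]; split.
  rewrite pairwise_cat p1 p2 !andbT; apply/allrelP => x y.
  move=> /i1[_ _ xs _] /i2[sy _ _ _].
  exact: le_trans sy.
move=> p; rewrite mem_cat => /orP[/i1|/i2] [? ? ? ?]; split => //;
  by [exact: le_trans st|exact: le_trans rs _].
Qed.

Lemma interval_list_nth (O : set R) (r s : R) l i : r <= s ->
  interval_list O r s l -> (i < size l)%N ->
  let p := nth (0, 0) l i in
  [/\ r <= p.1, p.1 <= p.2, p.2 <= s & `]p.1, p.2[ `<=` O].
Proof. by move=> rs [_ h] il p; apply: h; exact: mem_nth. Qed.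

(** Beyond the end of the list the default value gives empty intervals, so that
    disjointness extends to all indices. *)
Lemma interval_list_trivIset (O : set R) (r s : R) l : r <= s ->
  interval_list O r s l ->
  trivIset setT (fun i => `](nth (0, 0) l i).1, (nth (0, 0) l i).2[%classic).
Proof.
move=> rs hl; have out i : (size l <= i)%N ->
    `](nth (0, 0) l i).1, (nth (0, 0) l i).2[%classic = set0 :> set R.
  by move=> li; rewrite nth_default//= set_itvE.
have key i j : (i < j)%N -> 
   `](nth (0, 0) l i).1, (nth (0, 0) l i).2[%classic `&`
   `](nth (0, 0) l j).1, (nth (0, 0) l j).2[%classic = set0 :> set R.
  move=> ij; have [lj|jl] := leqP (size l) j; first by rewrite (out j)// setI0.
  have /= h := pairwiseP (0,0) hl.1 i j (ltn_trans ij jl) jl ij.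
  rewrite -subset0 => x [/=]; rewrite !in_itv/= => /andP[_ x1] /andP[x2 _].
  by have := lt_le_trans (lt_trans x2 x1) h; rewrite ltxx.
apply/trivIsetP => i j _ _; rewrite neq_ltn => /orP[] /key // h.
by rewrite setIC.
Qed.

Lemma itv_measure (x y : R) : x <= y ->
  lebesgue_measure (`]x, y[%classic : set R) = (y - x)%:E.
Proof.
move=> xy; rewrite lebesgue_measure_itv/= lte_fin; case: ltP => // yx.
by have -> : x = y by [apply/le_anti/andP]; rewrite subrr.
Qed.

Lemma interval_list_measure (O : set R) (r s : R) l : measurable O -> r <= s ->
  interval_list O r s l ->
  ((\sum_(p <- l) (p.2 - p.1))%:E <= lebesgue_measure O)%E.
Proof.
move=> mO rs hl.
pose F i : set R := `](nth (0, 0) l i).1, (nth (0, 0) l i).2[%classic.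
have Fsub : \big[setU/set0]_(i < size l) F i `<=` O.
  rewrite -(bigcup_mkord _ F); apply: bigcup_sub => i /= il.
  by have [_ _ _] := interval_list_nth rs hl il.
apply: (@le_trans _ _ (lebesgue_measure (\big[setU/set0]_(i < size l) F i))).
  rewrite measure_bigsetU; last 2 first.
  - by move=> i; exact: measurable_itv.
  - exact: interval_list_trivIset hl.
  rewrite (big_nth (0, 0)) big_mkord -sumEFin; apply: lee_sum => i _.
  have [_ h _ _] := interval_list_nth rs hl (ltn_ord i).
  by rewrite le_eqVlt; apply/orP; left; apply/eqP/esym; exact: itv_measure.
apply: (@le_measure _ _ _ (@lebesgue_measure R)) => //; rewrite inE//.
by apply: bigsetU_measurable => i _; exact: measurable_itv.
Qed.

End interval_lists.

Section increments.
Context {R : realType} {k : nat} (N : 'cV[R]_k -> R) (hN : is_norm N).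
Implicit Types (f : R -> 'cV[R]_k) (K : set 'cV[R]_k) (g dg : R -> R).

Lemma ac_interval_list f a b : abs_continuous a b f -> forall e, 0 < e ->
  exists2 d, 0 < d & forall (O : set R) l, a <= b -> interval_list O a b l ->
    \sum_(p <- l) (p.2 - p.1) < d ->
    \sum_(p <- l) N (f p.2 - f p.1) <= e.
Proof.
have [C C0 hC] := nrm_le_sup hN.
move=> acf e e0; have [d d0 hd] := acf (e / C) (divr_gt0 e0 C0).
exists d => // O l ab hl sl.
have := hd (size l) (fun i => (nth (0, 0) l i).1) (fun i => (nth (0, 0) l i).2).
have -> : \sum_(i < size l) ((nth (0, 0) l i).2 - (nth (0, 0) l i).1) =
    \sum_(p <- l) (p.2 - p.1) by rewrite [RHS](big_nth (0, 0)) big_mkord.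
move=> h; have {}h : \sum_(i < size l)
    `|f (nth (0, 0) l i).2 - f (nth (0, 0) l i).1| < e / C.
  apply: h => // [i|].
    by have [? ? ? _] := interval_list_nth ab hl (ltn_ord i).
  move=> i j _ _ hij; apply/val_inj.
  exact: (interval_list_trivIset ab hl I I hij).
rewrite (big_nth (0, 0)) big_mkord.
apply: (@le_trans _ _ (C * \sum_(i < size l)
    `|f (nth (0, 0) l i).2 - f (nth (0, 0) l i).1|)).
  by rewrite mulr_sumr; apply: ler_sum.
by rewrite mulrC -ler_pdivlMr// ltW.
Qed.

Lemma is_derive_nrm f t D : is_derive (t : R^o) (1 : R^o) f D ->
  forall e, 0 < e -> exists2 d, 0 < d &
    forall s, `|s - t| < d -> N (f s - f t - (s - t) *: D) <= e * `|s - t|.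
Proof.
have [C C0 hC] := nrm_le_sup hN.
move=> /is_derive_eps h e e0; have [d d0 hd] := h _ (divr_gt0 e0 C0).
exists d => // s /hd hs; apply: (le_trans (hC _)).
by rewrite mulrC -ler_pdivlMr// mulrAC.
Qed.

(** The point [t] lies between [r] and [s], so the two one-sided expansions at
    [t] add up without loss. *)
Lemma increment_local f g t D v dgt : is_derive (t : R^o) (1 : R^o) f D ->
  is_derive (t : R^o) (1 : R^o) g dgt -> N (D - v) <= dgt ->
  forall e, 0 < e -> exists2 d, 0 < d &
    forall r s, r <= t -> t <= s -> t - d < r -> s < t + d ->
      N (f s - f r - (s - r) *: v) <= g s - g r + e * (s - r).
Proof.
move=> fD gD hv e e0; have e2 : 0 < e / 2 by rewrite divr_gt0.
have [d1 d10 h1] := is_derive_nrm fD e2.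
have [d2 d20 h2] := (is_derive_eps g t dgt).1 gD _ e2.
exists (Num.min d1 d2); first by rewrite lt_min d10.
move=> r s rt ts dr ds.
have dm1 : Num.min d1 d2 <= d1 by rewrite ge_min lexx.
have dm2 : Num.min d1 d2 <= d2 by rewrite ge_min lexx orbT.
have as_ : `|s - t| = s - t by rewrite ger0_norm// subr_ge0.
have ar : `|r - t| = t - r by rewrite ler0_norm ?opprB// subr_le0.
have f1 : N (f s - f t - (s - t) *: D) <= e / 2 * (s - t).
  by have h := h1 s; rewrite as_ in h; apply: h; lra.
have f2 : N (f r - f t - (r - t) *: D) <= e / 2 * (t - r).
  by have h := h1 r; rewrite ar in h; apply: h; lra.
have g1 : `|g s - g t - (s - t) *: dgt| <= e / 2 * (s - t).
  by have h := h2 s; rewrite as_ in h; apply: h; lra.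
have g2 : `|g r - g t - (r - t) *: dgt| <= e / 2 * (t - r).
  by have h := h2 r; rewrite ar in h; apply: h; lra.
have -> : f s - f r - (s - r) *: v = (f s - f t - (s - t) *: D) -
    (f r - f t - (r - t) *: D) + (s - r) *: (D - v).
  apply/matrixP => i j; rewrite !mxE; ring.
apply: (le_trans (nrmD hN _ _)).
have := nrmB hN (f s - f t - (s - t) *: D) (f r - f t - (r - t) *: D).
rewrite (nrmZp hN); last lra.
have sr : 0 <= s - r by lra.
have := ler_wpM2l sr hv.
move: g1 g2; rewrite !ler_norml => /andP[+ _] /andP[_ +].
rewrite -![_ *: dgt]/(_ * dgt); lra.
Qed.

(** Cousin's lemma applied to the conclusion itself: it is additive because the
    means over adjacent intervals merge by convexity of [K], it holds near good
    points by [increment_local], and near points of [O] a small interval is simply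
    put on the list. *)
Lemma increment_near f g dg K a b (O : set R) (v0 : 'cV[R]_k) CK e : a <= b ->
  convexS K -> K v0 -> (forall v, K v -> N v <= CK) -> 0 < e ->
  (forall t, is_derive (t : R^o) (1 : R^o) g (dg t)) ->
  (forall r s, a <= r -> r <= s -> s <= b -> g r <= g s) ->
  open O ->
  (forall t, a <= t -> t <= b -> O t \/
     exists D v, [/\ is_derive (t : R^o) (1 : R^o) f D, K v
                   & N (D - v) <= dg t]) ->
  exists v l, [/\ K v, interval_list O a b l &
    N (f b - f a - (b - a) *: v) <= g b - g a + e * (b - a) +
      (\sum_(p <- l) N (f p.2 - f p.1) + CK * \sum_(p <- l) (p.2 - p.1))].
Proof.
move=> ab cK Kv0 hCK e0 gd gm oO hf.
have CK0 : 0 <= CK by apply: le_trans (hCK _ Kv0); exact: (nrm_ge0 hN).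
pose P r s := exists v l, [/\ K v, interval_list O r s l &
    N (f s - f r - (s - r) *: v) <= g s - g r + e * (s - r) +
      (\sum_(p <- l) N (f p.2 - f p.1) + CK * \sum_(p <- l) (p.2 - p.1))].
apply: (@cousin _ P) => //.
- move=> r s t ar rs st tb [v1 [l1 [Kv1 hl1 h1]]] [v2 [l2 [Kv2 hl2 h2]]].
  have hl : interval_list O r t (l1 ++ l2) by exact: interval_list_cat hl1 hl2.
  have [rt|tr] := ltP r t; last first.
    have [rs' st'] : r = s /\ s = t by split; apply/le_anti/andP; split; lra.
    subst s t; exists v1, (l1 ++ l2); split => //; rewrite !big_cat/= mulrDr.
    apply: (le_trans h1).
    suff : 0 <= \sum_(i <- l2) N (f i.2 - f i.1) +
        CK * \sum_(i <- l2) (i.2 - i.1) by lra.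
    rewrite addr_ge0 ?mulr_ge0//.
      by apply: sumr_ge0 => i _; exact: (nrm_ge0 hN).
    rewrite big_seq sumr_ge0// => i /hl2.2[_ h _ _]; by rewrite subr_ge0.
  have tr0 : t - r != 0 by rewrite subr_eq0 gt_eqF.
  pose c := (s - r) / (t - r).
  have c1 : 1 - c = (t - s) / (t - r) by rewrite /c; field.
  exists (c *: v1 + (1 - c) *: v2), (l1 ++ l2); split => //.
    apply: cK => //; first by rewrite divr_ge0// subr_ge0// ltW.
    by rewrite ler_pdivrMr ?subr_gt0// mul1r lerD2r.
  have -> : f t - f r - (t - r) *: (c *: v1 + (1 - c) *: v2) =
      (f s - f r - (s - r) *: v1) + (f t - f s - (t - s) *: v2).
    rewrite c1 /c; apply/matrixP => i j; rewrite !mxE; field.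
    by rewrite subr_eq0 gt_eqF.
  apply: (le_trans (nrmD hN _ _)); rewrite !big_cat/=; lra.
- move=> t at_ tb; have [Ot|[D [v [fD Kv hv]]]] := hf t at_ tb.
    have /nbhs_ballP[d /= d0 hd] := oO _ Ot.
    exists d => // r s ar rt ts sb dr ds.
    exists v0, [:: (r, s)]; split => //.
      split => // p; rewrite inE => /eqP -> /=; split => //.
        exact: le_trans ts.
      move=> x /=; rewrite in_itv/= => /andP[rx xs]; apply: hd.
      rewrite -ball_normE /ball_/= ltr_norml; apply/andP; split; lra.
    rewrite !big_cons !big_nil/= !addr0; apply: (le_trans (nrmB hN _ _)).
    rewrite (nrmZp hN); last lra.
    have := gm r s ar (le_trans rt ts) sb.
    have := hCK _ Kv0.
    have : 0 <= s - r by lra.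
    nra.
  have [d d0 hd] := increment_local fD (gd t) hv e0.
  exists d => // r s ar rt ts sb dr ds; exists v, [::]; split => //.
  by rewrite !big_nil mulr0 !addr0; exact: hd.
Qed.
Lemma nondecreasing_of_derive g dg a b :
  (forall t, is_derive (t : R^o) (1 : R^o) g (dg t)) ->
  (forall t, a <= t -> t <= b -> 0 <= dg t) ->
  forall r s, a <= r -> r <= s -> s <= b -> g r <= g s.
Proof.
move=> gd dg0 r s ar; rewrite le_eqVlt => /orP[/eqP ->//|rs] sb.
have [|c crs e] := @MVT R g dg r s rs (fun x _ => gd x).
  apply: continuous_subspaceT => x; apply: differentiable_continuous.
  by apply/derivable1_diffP; exact: (@ex_derive _ _ _ _ _ _ _ (gd x)).
move: crs; rewrite in_itv/= => /andP[rc cs].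
rewrite -subr_ge0 e mulr_ge0//; last by rewrite subr_ge0 ltW.
apply: dg0; lra.
Qed.

(** The exceptional null set is covered by an open set of small measure.  The
    intervals listed by [increment_near] lie inside it, so that absolute continuity
    makes their contribution small; compactness of [K] then turns approximate
    means into an exact one. *)
Lemma increment_hull f g dg K a b : a <= b ->
  compact K -> convexS K -> K !=set0 -> abs_continuous a b f ->
  (forall t, is_derive (t : R^o) (1 : R^o) g (dg t)) ->
  (forall t, a <= t -> t <= b -> 0 <= dg t) ->
  {ae lebesgue_measure, forall t : R, t \in `[a, b] ->
     exists D v, [/\ is_derive (t : R^o) (1 : R^o) f D, K v
                   & N (D - v) <= dg t]} ->
  exists2 v, K v & N (f b - f a - (b - a) *: v) <= g b - g a.
Proof.
move=> ab cK vK [v0 Kv0] acf gd dg0 aef.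
have gm := nondecreasing_of_derive gd dg0.
have [CK hCK] := compact_bounded_by hN cK.
have CK0 : 0 <= CK by apply: le_trans (hCK _ Kv0); exact: (nrm_ge0 hN).
pose W v := N (f b - f a - (b - a) *: v).
have cW : continuous W.
  have [C C0 hC] := nrm_le_sup hN.
  apply: (@cont_of_lip _ 'cV[R]_k R^o _ (C * `|b - a|)) => x y.
  apply: (le_trans (nrm_dist hN _ _)); apply: (le_trans (hC _)).
  have -> : f b - f a - (b - a) *: x - (f b - f a - (b - a) *: y) =
      - ((b - a) *: (x - y)) by apply/matrixP => i j; rewrite !mxE; ring.
  by rewrite normrN normrZ mulrA.
have [v vinK hv] : exists2 c, c \in K & forall t, t \in K -> W c <= W t.
  apply: compact_EVT_min => //; first by exists v0.
  exact: continuous_subspaceT.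
exists v; first by rewrite inE in vinK.
apply/ler_addgt0Pr => e e0.
(* one third of [e] for the local errors, one for the variation of [f] and one
   for the means over the listed intervals *)
have e3 : 0 < e / 3 by rewrite divr_gt0.
have [d d0 hd] := ac_interval_list acf e3.
pose eta := Num.min (d / 2) (e / 3 / (CK + 1)).
have CK1 : 0 < CK + 1 by rewrite ltr_wpDl.
have eta0 : 0 < eta by rewrite lt_min !divr_gt0.
move/negligible_outer_measure : aef => aef.
have [G [oG EG]] := outer_measure_open_le
  (~` [set t | t \in `[a, b] -> exists D v,
    [/\ is_derive (t : R^o) (1 : R^o) f D, K v & N (D - v) <= dg t]]) eta0.
rewrite [X in (_ <= X + _)%E]aef add0e => mG.
have ba1 : 0 < b - a + 1 by lra.
have e4 : 0 < e / 3 / (b - a + 1) by rewrite divr_gt0.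
have [|v1 [l [Kv1 hl h1]]] := @increment_near f g dg K a b G v0 CK _ ab vK Kv0
  hCK e4 gd gm oG.
  move=> t at_ tb; have [Gt|nGt] := pselect (G t); first by left.
  right; have [h|h] := pselect (t \in `[a, b] -> exists D v,
    [/\ is_derive (t : R^o) (1 : R^o) f D, K v & N (D - v) <= dg t]).
    by apply: h; rewrite in_itv/= at_.
  by exfalso; apply: nGt; apply: EG.
have len : \sum_(p <- l) (p.2 - p.1) <= eta.
  rewrite -lee_fin; apply: le_trans mG.
  by apply: interval_list_measure hl => //; exact: open_measurable.
have len1 : \sum_(p <- l) N (f p.2 - f p.1) <= e / 3.
  apply: (hd G) => //; apply: (le_lt_trans len); rewrite /eta.
  by apply: (@le_lt_trans _ _ (d / 2)); [rewrite ge_min lexx|lra].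
have len2 : CK * \sum_(p <- l) (p.2 - p.1) <= e / 3.
  apply: (@le_trans _ _ (CK * (e / 3 / (CK + 1)))).
    by rewrite ler_wpM2l// (le_trans len)// ge_min lexx orbT.
  by rewrite mulrA ler_pdivrMr//; nra.
have len3 : e / 3 / (b - a + 1) * (b - a) <= e / 3.
  by rewrite mulrAC ler_pdivrMr//; nra.
have : W v <= W v1 by apply: hv; rewrite inE.
rewrite /W; lra.
Qed.

End increments.

(** * Almost everywhere statements *)

Lemma ae_imp (R : realType) (P Q : R -> Prop) : (forall t, P t -> Q t) ->
  {ae lebesgue_measure, forall t : R, P t} ->
  {ae lebesgue_measure, forall t : R, Q t}.
Proof.
move=> PQ; rewrite /almost_everywhere/prop_near1/= => h.
by apply: negligibleS h => t /= nQ hP; exact/nQ/PQ.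
Qed.

Lemma ae_imp2 (R : realType) (P P' Q : R -> Prop) :
  (forall t, P t -> P' t -> Q t) ->
  {ae lebesgue_measure, forall t : R, P t} ->
  {ae lebesgue_measure, forall t : R, P' t} ->
  {ae lebesgue_measure, forall t : R, Q t}.
Proof.
move=> PQ; rewrite /almost_everywhere/prop_near1/= => h h'.
apply: negligibleS (negligibleU h h') => t /= nQ.
have [hP|hP] := pselect (P t); last by left.
by right => hP'; exact/nQ/PQ.
Qed.

Lemma ae_and (R : realType) (P P' : R -> Prop) :
  {ae lebesgue_measure, forall t : R, P t} ->
  {ae lebesgue_measure, forall t : R, P' t} ->
  {ae lebesgue_measure, forall t : R, P t /\ P' t}.
Proof. exact: ae_imp2. Qed.

(** * Scalar majorants *)

Section exponential_majorants.
Context {R : realType}.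

(** The scalar majorants of the increment estimates all have this form, up to
    additive constants, so one derivative formula serves for all of them. *)
Definition expquad (M a c1 c2 c3 : R) (t : R) : R :=
  c1 * expR (M * (t - a)) + c2 * t + c3 * t ^+ 2.

Lemma is_derive_expquad (M a c1 c2 c3 t : R) :
  is_derive (t : R^o) (1 : R^o) (expquad M a c1 c2 c3 : R -> R)
    (c1 * (M * expR (M * (t - a))) + c2 + c3 * (2 * t)).
Proof.
have d1 : is_derive (t : R^o) (1 : R^o) (fun t : R => M * (t - a)) M.
  apply: is_derive_eq; rewrite /GRing.scale/=; ring.
have d2 := @is_derive1_comp _ expR (fun t : R => M * (t - a)) t _ _
  (is_derive_expR _) d1.
rewrite /expquad.
have -> : (fun t : R => c1 * expR (M * (t - a)) + c2 * t + c3 * t ^+ 2) =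
  (fun t : R => c1 * (expR \o (fun t : R => M * (t - a))) t + c2 * t + c3 * t ^+ 2)
  by [].
apply: is_derive_eq; rewrite /GRing.scale/=; ring.
Qed.

Lemma expquad_cont (M a c1 c2 c3 : R) : continuous (expquad M a c1 c2 c3).
Proof.
move=> t; apply: differentiable_continuous; apply/derivable1_diffP.
exact: (@ex_derive _ _ _ _ _ _ _ (is_derive_expquad M a c1 c2 c3 t)).
Qed.

(** Extends functions on a segment to the line: continuity on the segment becomes
    continuity everywhere. *)
Definition clamp (a b t : R) : R := Num.max a (Num.min b t).

Lemma clamp_in a b t : a <= b -> a <= clamp a b t /\ clamp a b t <= b.
Proof.
move=> ab; rewrite /clamp le_max lexx ge_max ab/=; split => //.
by rewrite ge_min lexx.
Qed.

Lemma clamp_id a b t : a <= t -> t <= b -> clamp a b t = t.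
Proof. by move=> at_ tb; rewrite /clamp (min_idPr tb) (max_idPr at_). Qed.

Lemma clamp_dist a b s t : a <= b -> `|clamp a b s - clamp a b t| <= `|s - t|.
Proof.
move=> ab; rewrite /clamp.
have [bs|sb] := leP b s; have [bt|tb] := leP b t; rewrite ?(max_idPr ab);
  have [at_|ta] := leP a t; have [as_|sa] := leP a s;
  rewrite ?subrr ?normr0 ?normr_ge0//;
  have := ler_norm (s - t); have := ler_norm (t - s); rewrite (distrC t s);
  move=> g1 g2; rewrite ler_norml; apply/andP; split; lra.
Qed.

Lemma clamp_continuous a b : a <= b -> continuous (clamp a b).
Proof.
move=> ab; apply: (@cont_of_lip _ R^o R^o _ 1) => s t.
by rewrite mul1r; exact: clamp_dist.
Qed.

End exponential_majorants.

(** * Stability of absolute continuity *)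

Section ac_functions.
Context {R : realType} {V : normedModType R}.
Implicit Types f h : R -> V.

Lemma ac_sub f a b c d : a <= c -> d <= b ->
  abs_continuous a b f -> abs_continuous c d f.
Proof.
move=> ac db hf e e0; have [dl d0 hd] := hf e e0; exists dl => // k l r hlr.
by apply: hd => i; have [? ? ?] := hlr i; split => //;
  [exact: le_trans ac _|exact: le_trans db].
Qed.

Lemma ac_subtract f h a b : abs_continuous a b f -> abs_continuous a b h ->
  abs_continuous a b (fun t => f t - h t).
Proof.
move=> hf hh e e0; have e2 : 0 < e / 2 by rewrite divr_gt0.
have [d1 d10 h1] := hf _ e2; have [d2 d20 h2] := hh _ e2.
exists (Num.min d1 d2); first by rewrite lt_min d10.
move=> k l r hlr tr; rewrite lt_min => /andP[s1 s2].
have := h1 k l r hlr tr s1; have := h2 k l r hlr tr s2 => g2 g1.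
apply: (@le_lt_trans _ _ (\sum_(i < k) `|f (r i) - f (l i)| +
                          \sum_(i < k) `|h (r i) - h (l i)|)); last lra.
rewrite -big_split/=; apply: ler_sum => i _.
have -> : f (r i) - h (r i) - (f (l i) - h (l i)) =
  (f (r i) - f (l i)) - (h (r i) - h (l i)).
  by rewrite !opprD !opprK addrACA.
exact: ler_normB.
Qed.

Lemma ac_lip f a b C : (forall s t, a <= s -> s <= t -> t <= b ->
    `|f t - f s| <= C * (t - s)) -> abs_continuous a b f.
Proof.
move=> hf e e0; have C0 : 0 < `|C| + 1 by rewrite ltr_wpDl.
exists (e / (`|C| + 1)); first exact: divr_gt0.
move=> k l r hlr _; rewrite ltr_pdivlMr// mulrC; apply: le_lt_trans.
rewrite mulr_sumr; apply: ler_sum => i _; have [h1 h2 h3] := hlr i.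
apply: (le_trans (hf _ _ h1 h2 h3)); rewrite ler_wpM2r ?subr_ge0//.
by rewrite (le_trans (ler_norm _))// lerDl.
Qed.

Lemma ac_modulus f a b : abs_continuous a b f -> forall e, 0 < e ->
  exists2 d, 0 < d & forall s t, a <= s -> s <= b -> a <= t -> t <= b ->
    `|s - t| < d -> `|f s - f t| < e.
Proof.
move=> hf e e0; have [d d0 hd] := hf e e0; exists d => // s t.
wlog ts : s t / t <= s.
  move=> hw a1 b1 a2 b2; have [|/ltW] := leP t s; first by move=> /hw; apply.
  by move=> /hw h; rewrite distrC (distrC (f s)); apply: h.
move=> a1 b1 a2 b2; rewrite ger0_norm ?subr_ge0// => st.
have := hd 1%N (fun=> t) (fun=> s); rewrite !big_ord1; apply => //.
by move=> i j _ _ _; rewrite (ord1 i) (ord1 j).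
Qed.

Lemma ac_clamp_cont f a b : a <= b -> abs_continuous a b f ->
  continuous (fun t : R => f (clamp a b t)).
Proof.
move=> ab hf t; apply/cvgrPdist_lt => /= e e0; apply/nbhs_ballP.
have [d d0 hd] := ac_modulus hf e0; exists d => // s.
rewrite /ball_/= => st.
have [a1 b1] := clamp_in t ab; have [a2 b2] := clamp_in s ab.
by apply: hd => //; apply: le_lt_trans st; exact: clamp_dist.
Qed.

End ac_functions.

(** * Gronwall inequality *)

Section gronwall.
Context {R : realType} {k : nat} (N : 'cV[R]_k -> R) (hN : is_norm N).

(** Mean value inequality: the case of a single mean value [v]. *)
Lemma increment_le (f : R -> 'cV[R]_k) (g dg : R -> R) v a b : a <= b ->
  abs_continuous a b f ->
  (forall t, is_derive (t : R^o) (1 : R^o) g (dg t)) ->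
  (forall t, a <= t -> t <= b -> 0 <= dg t) ->
  {ae lebesgue_measure, forall t : R, t \in `[a, b] ->
     exists2 D, is_derive (t : R^o) (1 : R^o) f D & N (D - v) <= dg t} ->
  N (f b - f a - (b - a) *: v) <= g b - g a.
Proof.
move=> ab acf gd dg0 aef.
suff [_ -> //] : exists2 v', [set v] v' &
  N (f b - f a - (b - a) *: v') <= g b - g a by [].
apply: (increment_hull hN ab _ _ _ acf gd dg0).
- exact: compact_set1.
- by move=> x y c _ _ -> ->; rewrite -scalerDl subrKC scale1r.
- by exists v.
by apply: (ae_imp _ aef) => t h /h[D fD hD]; exists D, v.
Qed.

(** Compare [N (w t)] with the solution [E] of [E' = M E + c] that starts slightly
    above.  At a point where the quotient [N (w t) / E t] is maximal, a maximum at
    least 1 would contradict the mean value inequality with majorant this maximum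
    times [E]. *)
Lemma gronwall (w : R -> 'cV[R]_k) (M c a b : R) : 0 < M -> 0 <= c ->
  abs_continuous a b w ->
  {ae lebesgue_measure, forall t : R, t \in `[a, b] ->
     exists2 D, is_derive (t : R^o) (1 : R^o) w D & N D <= M * N (w t) + c} ->
  forall t, a <= t -> t <= b ->
    N (w t) <= expR (M * (t - a)) * N (w a) +
               c / M * (expR (M * (t - a)) - 1).
Proof.
move=> M0 c0 acw aew t at_ tb; have ab := le_trans at_ tb.
set p := N (w a); have p0 : 0 <= p by exact: (nrm_ge0 hN).
have cM0 : 0 <= c / M by rewrite divr_ge0// ltW.
apply/ler_addgt0Pr => e e0.
pose eps := e / expR (M * (t - a)).
have eps0 : 0 < eps by rewrite divr_gt0// expR_gt0.
(* the majorant solving E' = M E + c with the initial value p + eps *)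
pose c1 := p + eps + c / M.
pose E s := c1 * expR (M * (s - a)) - c / M.
have E_ge s : a <= s -> p + eps <= E s.
  move=> as_; have : 1 <= expR (M * (s - a)).
    rewrite -[leLHS]expR0 ler_expR mulr_ge0 ?subr_ge0//; exact: ltW.
  rewrite /E /c1; nra.
pose h s := N (w (clamp a b s)) / E (clamp a b s).
have ch : continuous h.
  move=> s; apply: (@continuousM _ _ (fun s => N (w (clamp a b s)))).
    apply: (@continuous_comp _ _ _ (fun s => w (clamp a b s)) N).
      exact: ac_clamp_cont.
    exact: (nrm_cont hN).
  have [cl _] := clamp_in s ab.
  apply: (@continuousV _ _ (fun s => E (clamp a b s))).
    by rewrite gt_eqF//; have := E_ge _ cl; lra.
  apply: (@continuous_comp _ _ _ (clamp a b) E); first exact: clamp_continuous.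
  have -> : E = (fun s => expquad M a c1 0 0 s - c / M).
    by apply/funext => u; rewrite /E /expquad; ring.
  apply: (@continuousB _ _ _ (expquad M a c1 0 0)); first exact: expquad_cont.
  exact: cst_continuous.
have [s sab hs] := EVT_max ab (continuous_subspaceT ch).
move: sab; rewrite in_itv/= => /andP[as_ sb].
have hE u : a <= u -> u <= b -> N (w u) <= h s * E u.
  move=> au ub; have E0 : 0 < E u by have := E_ge _ au; lra.
  rewrite -ler_pdivrMr//; have := hs u; rewrite in_itv/= au ub /h => /(_ isT).
  by rewrite (clamp_id au ub).
suff hs1 : h s <= 1.
  apply: (@le_trans _ _ (E t)).
    apply: (le_trans (hE t at_ tb)); rewrite ger_pMl//.
    by have := E_ge _ at_; lra.
  have -> : e = eps * expR (M * (t - a)) by rewrite /eps divfK// gt_eqF// expR_gt0.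
  by rewrite /E /c1 le_eqVlt; apply/orP; left; apply/eqP; ring.
rewrite leNgt; apply/negP => hs1.
have := @increment_le w (expquad M a (h s * c1) 0 0) _ 0 a s as_
  (ac_sub (lexx _) sb acw) (is_derive_expquad _ _ _ _ _).
rewrite scaler0 subr0 => inc.
have {}inc : N (w s - w a) <= h s * (E s - E a).
  have -> : h s * (E s - E a) =
      expquad M a (h s * c1) 0 0 s - expquad M a (h s * c1) 0 0 a.
    rewrite /expquad /E; ring.
  have c10 : 0 <= c1 by rewrite /c1; lra.
  apply: inc => [u au us|].
    have hs0 : 0 <= h s by apply: ltW; apply: lt_trans hs1.
    by rewrite mul0r !addr0 mulr_ge0 ?(mulr_ge0 hs0)// mulr_ge0 ?expR_ge0// ltW.
  apply: (ae_imp _ aew) => u hu; rewrite in_itv/= => /andP[au us].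
  have [|D wD hD] := hu; first by rewrite in_itv/= au (le_trans us).
  exists D => //; rewrite subr0; apply: (le_trans hD).
  have := hE u au (le_trans us sb); rewrite /E => hu'.
  have -> : h s * c1 * (M * expR (M * (u - a))) + 0 + 0 * (2 * u) =
    M * (h s * (c1 * expR (M * (u - a)) - c / M)) + h s * c.
    by field; rewrite gt_eqF.
  have := ler_wpM2l (ltW M0) hu'; have : c <= h s * c by rewrite ler_peMl// ltW.
  lra.
have hsE : N (w s) = h s * E s.
  rewrite /h (clamp_id as_ sb) divfK// gt_eqF//; have := E_ge _ as_; lra.
have := nrm_rev hN (w s) (w a); rewrite hsE -/p.
have : E a = p + eps by rewrite /E subrr mulr0 expR0 /c1; ring.
move=> Ea; rewrite Ea in inc; nra.
Qed.

End gronwall.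

(** * Elementary inequalities and Lipschitz bounds *)

Section exponential_inequalities.
Context {R : realType}.
Implicit Types z l M h : R.

Lemma expR_tangent (x y : R) : expR x * (1 + (y - x)) <= expR y.
Proof.
have -> : expR y = expR x * expR (y - x) by rewrite -expRD addrC subrK.
by rewrite ler_wpM2l ?expR_ge0// expR_ge1Dx.
Qed.

Lemma rfun_ge0 M h : 0 <= rfun M h.
Proof. by rewrite /rfun; have := expR_ge1Dx (h * M); lra. Qed.

(** The function is convex and vanishes at the origin: the tangent of the
    exponential at [l * (h * M)] is evaluated at [h * M] and at 0. *)
Lemma rfun_scale_le M h l : 0 <= l -> l <= 1 -> rfun M (l * h) <= l * rfun M h.
Proof.
move=> l0 l1; rewrite /rfun.
have e1 := expR_tangent (l * (h * M)) (h * M).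
have e2 := expR_tangent (l * (h * M)) 0.
rewrite expR0 in e2; rewrite -!mulrA.
have f1 := ler_wpM2l l0 e1.
have l2 : 0 <= 1 - l by lra.
have f2 := ler_wpM2l l2 e2.
lra.
Qed.

Lemma rfun_ge_sqr M h : 0 <= M -> 0 <= h -> (h * M) ^+ 2 / 2 <= rfun M h.
Proof.
move=> M0 h0; rewrite /rfun; have := mulr_ge0 h0 M0; move: (h * M) => z z0.
have := @nondecreasing_of_derive R (expquad 1 0 1 (-1) (- (1 / 2)))  _ 0 z
  (is_derive_expquad _ _ _ _ _) _ 0 z (lexx _) z0 (lexx _).
rewrite /expquad !subr0 !mul1r !mulr0 expR0 => mono.
suff : 1 + 0 + - 2^-1 * 0 ^+ 2 <= expR z + -1 * z + - 2^-1 * z ^+ 2.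
  by rewrite expr0n/= mulr0; lra.
apply: mono => t t0 tz; rewrite !mul1r !subr0; have := expR_ge1Dx t; lra.
Qed.

Lemma expR_sub1_le z : 0 <= z -> expR z - 1 <= z * expR z.
Proof. by move=> z0; have := expR_tangent z 0; rewrite expR0; lra. Qed.

Lemma rfun_le_sqr M h : 0 <= M -> 0 <= h ->
  rfun M h <= (h * M) ^+ 2 * expR (h * M).
Proof.
move=> M0 h0; rewrite /rfun; have := mulr_ge0 h0 M0; move: (h * M) => z z0.
have e1 := expR_sub1_le z0; have e2 := ler_wpM2l z0 e1.
have : z <= z * expR z by rewrite ler_peMr// -expR0 ler_expR.
move: e2; rewrite mulrA -expr2; lra.
Qed.

End exponential_inequalities.

(** The factor [1 + c * h] is at most [expR (c * h)], and these accumulate to the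
    exponential of the elapsed time. *)
Lemma discrete_gronwall (R : realType) (a : nat -> R) (c d h : R) (N : nat) :
  0 <= c -> 0 <= d -> 0 <= h -> 0 <= a 0%N ->
  (forall i, (i < N)%N -> a i.+1 <= (1 + c * h) * a i + d * h) ->
  forall i, (i <= N)%N ->
    a i <= expR (c * (i%:R * h)) * (a 0%N + d * (i%:R * h)).
Proof.
move=> c0 d0 h0 a0 ha; elim=> [_|i IH iN].
  by rewrite mul0r !mulr0 expR0 addr0 mul1r.
have b0 : 0 <= a 0%N + d * (i%:R * h) by rewrite addr_ge0 ?mulr_ge0.
have e1 : 1 <= expR (c * (i.+1%:R * h)).
  by rewrite -expR0 ler_expR !mulr_ge0.
have e2 : 1 + c * h <= expR (c * h) by exact: expR_ge1Dx.
have ch : 0 <= 1 + c * h by rewrite addr_ge0 ?mulr_ge0.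
have Ei : expR (c * (i.+1%:R * h)) = expR (c * h) * expR (c * (i%:R * h)).
  by rewrite -expRD -natr1; congr expR; ring.
have h1 := ler_wpM2l ch (IH (ltnW iN)).
have h2 : 0 <= expR (c * (i%:R * h)) * (a 0%N + d * (i%:R * h)).
  by rewrite mulr_ge0 ?expR_ge0.
have h3 := ler_wpM2r h2 e2.
have h4 : d * h <= expR (c * (i.+1%:R * h)) * (d * h).
  by rewrite ler_peMl// mulr_ge0.
apply: (le_trans (ha i iN)).
have -> : a 0%N + d * (i.+1%:R * h) = a 0%N + d * (i%:R * h) + d * h.
  by rewrite -natr1; ring.
rewrite mulrDr [X in _ <= X * _ + _]Ei -mulrA; lra.
Qed.

Section lipschitz_bounds.
Context {R : realType}.

(** The derivative is relative to the segment and every point is good, so Cousin's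
    lemma applies directly to the inequality with [C] slightly enlarged. *)
Lemma lip_of_derivative (k : nat) (N : 'cV[R]_k -> R) (f : R -> 'cV[R]_k)
    (a b C : R) : is_norm N -> a <= b ->
  (forall t, a <= t -> t <= b -> exists2 D, N D <= C & forall e, 0 < e ->
     exists2 d, 0 < d & forall s, a <= s -> s <= b -> `|s - t| < d ->
       N (f s - f t - (s - t) *: D) <= e * `|s - t|) ->
  N (f b - f a) <= C * (b - a).
Proof.
move=> hN ab hf; apply/ler_addgt0Pr => e e0.
have ba : 0 < b - a + 1 by lra.
pose e' := e / (b - a + 1); have e'0 : 0 < e' by rewrite divr_gt0.
pose P r s := N (f s - f r) <= (C + e') * (s - r).
suff : P a b.
  rewrite /P => h; apply: (le_trans h); rewrite mulrDl lerD2l.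
  by rewrite /e' mulrAC ler_pdivrMr//; nra.
apply: (@cousin _ P) => //.
  move=> r s t _ _ _; rewrite /P => h1 h2.
  have := nrm_tri hN (f s) (f t) (f r); lra.
move=> t at_ tb; have [D DC hD] := hf t at_ tb; have [d d0 hd] := hD _ e'0.
exists d => // r s ar rt ts sb dr ds; rewrite /P.
have := hd s (le_trans at_ ts) sb; have := hd r ar (le_trans rt tb).
rewrite (ger0_norm (_ : 0 <= s - t)) ?subr_ge0//.
rewrite (ler0_norm (_ : r - t <= 0)) ?subr_le0// opprB => h1 h2.
have {}h1 := h1 (ltac:(lra)); have {}h2 := h2 (ltac:(lra)).
have -> : f s - f r = (f s - f t - (s - t) *: D) - (f r - f t - (r - t) *: D)
    + (s - r) *: D by apply/matrixP => i j; rewrite !mxE; ring.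
apply: (le_trans (nrmD hN _ _)).
have := nrmB hN (f s - f t - (s - t) *: D) (f r - f t - (r - t) *: D).
have sr : 0 <= s - r by lra.
rewrite (nrmZp hN)//; have := ler_wpM2l sr DC; lra.
Qed.

Lemma C1_lip (p q : nat) (Np : 'cV[R]_p -> R) (Nq : 'cV[R]_q -> R)
    (f : R -> 'M[R]_(p, q)) (a b M : R) : is_norm Np -> is_norm Nq ->
  C1_on a b f ->
  (forall t, t \in `[a, b] ->
     opnorm Nq Np (derive_within `[a, b]%classic f t) <= M) ->
  forall s t x, a <= s -> s <= t -> t <= b ->
    Np ((f t - f s) *m x) <= M * (t - s) * Nq x.
Proof.
move=> hp hq [fd _] hM s t x as_ st tb.
have [C C0 hC] := nrm_le_sup hp.
rewrite mulmxBl mulrAC.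
apply: (@lip_of_derivative _ _ (fun t => f t *m x)) => // u su ut.
have uab : u \in `[a, b] by rewrite in_itv/= (le_trans as_)// (le_trans ut).
exists (derive_within `[a, b]%classic f u *m x).
  exact: opnorm_bound hp hq _ _ _ (hM u uab).
move=> e e0; pose L := C * (q%:R * `|x|) + 1.
have L0 : 0 < L by rewrite ltr_wpDl// !mulr_ge0 ?(ltW C0).
have /cvgrPdist_le /(_ _ (divr_gt0 e0 L0)) := fd u uab.
rewrite near_withinE near_withinE => /nbhs_ballP[d /= d0 hd].
exists d => // v sv vt vu.
have [->|vu0] := eqVneq v u.
  by rewrite !subrr scale0r subr0 normr0 mulr0 (nrm0 hp).
have vab : v \in `[a, b] by rewrite in_itv/= (le_trans as_)// (le_trans vt).
have vu' : `|u - v| < d by rewrite distrC.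
have := hd v vu' vu0 vab.
rewrite -/(derive_within _ _ _) /diff_quotient => h.
set D := derive_within _ _ _ in h *.
have -> : f v *m x - f u *m x - (v - u) *: (D *m x) =
    - ((v - u) *: ((D - (v - u)^-1 *: (f v - f u)) *m x)).
  rewrite mulmxBl -scalemxAl scalerBr scalerA divff ?subr_eq0// scale1r opprB.
  by rewrite mulmxBl.
rewrite (nrmN hp) (nrmZ hp) mulrC ler_wpM2r//.
apply: (le_trans (hC _)).
have := mulmx_sup_le (D - (v - u)^-1 *: (f v - f u)) x.
move=> /(ler_wpM2l (ltW C0)) h2; apply: (le_trans h2).
have : C * (q%:R * `|x|) * (e / L) <= e.
  rewrite mulrA ler_pdivrMr// mulrC ler_wpM2l ?(ltW e0)// /L.
  by rewrite lerDl.
apply: le_trans.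
rewrite -!mulrA ler_wpM2l ?(ltW C0)// ler_wpM2l// [leRHS]mulrC.
by rewrite ler_wpM2r.
Qed.

End lipschitz_bounds.

(** * Matrix derivatives, antiderivatives, concatenation of trajectories *)

Section matrix_derivatives.
Context {R : realType}.

Lemma is_derive_mxP (p q : nat) (M : R -> 'M[R]_(p, q)) (t : R) D :
  is_derive (t : R^o) (1 : R^o) M D <->
  forall i j, is_derive (t : R^o) (1 : R^o) (fun s => M s i j : R^o) (D i j).
Proof.
split=> [[dM vM] i j|h].
  split; first exact: (derivable_mxP (M : R^o -> _) t 1).1.
  by move: vM; rewrite derive_mx// => /matrixP/(_ i j); rewrite mxE.
have dM : derivable (M : R^o -> _) t 1.
  by apply/derivable_mxP => i j; have [] := h i j.
split => //; rewrite derive_mx//; apply/matrixP => i j; rewrite mxE.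
by have [] := h i j.
Qed.

Lemma is_derive_mulmx (p q r : nat) (M : R -> 'M[R]_(p, q))
    (L : R -> 'M[R]_(q, r)) (t : R) dM dL :
  is_derive (t : R^o) (1 : R^o) M dM -> is_derive (t : R^o) (1 : R^o) L dL ->
  is_derive (t : R^o) (1 : R^o) (fun s => M s *m L s)
    (dM *m L t + M t *m dL).
Proof.
move=> /is_derive_mxP hM /is_derive_mxP hL; apply/is_derive_mxP => i j.
have -> : (fun s => (M s *m L s) i j : R^o) =
    \sum_k ((fun s => M s i k : R^o) * (fun s => L s k j : R^o)).
  apply/funext => s; rewrite mxE fct_sumE; exact: eq_bigr.
apply: is_derive_eq.
rewrite !mxE -big_split/=; apply: eq_bigr => k _.
by rewrite addrC (mulrC (dM i k)).
Qed.

(** Integration starts at [a - 1] so that [a] is an interior point and the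
    two-sided derivative exists there as well. *)
Lemma antiderivative (k : nat) (f : R -> 'cV[R]_k) (a : R) : continuous f ->
  exists2 F : R -> 'cV[R]_k, F a = 0 &
    forall t, a <= t -> is_derive (t : R^o) (1 : R^o) F (f t).
Proof.
move=> cf.
have cfi i : continuous (fun t => f t i 0).
  move=> t; apply/cvgrPdist_le => /= e e0.
  move: (cf t) => /cvgrPdist_le/(_ _ e0); apply: filterS => s.
  apply: le_trans.
  by have := abs_entry_le (f t - f s) i; rewrite !mxE.
pose P i t := \int[@lebesgue_measure R]_(x in `[a - 1, t]) f x i 0.
exists (fun t => \col_i (P i t - P i a)).
  by apply/matrixP => i j; rewrite !mxE subrr.
move=> t at_; apply/is_derive_mxP => i j; rewrite (ord1 j).
have -> : (fun s => (\col_i (P i s - P i a)) i 0 : R^o) =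
    (fun s => P i s : R^o) - cst (P i a).
  by apply/funext => s; rewrite mxE.
have [dP vP] : derivable (P i) t 1 /\ ((P i : R -> R)^`()%classic) t = f t i 0.
  apply: (@continuous_FTC1_closed R (fun x => f x i 0) (a - 1) t (t + 1)).
  - by rewrite ltrDl.
  - apply: continuous_compact_integrable; first exact: segment_compact.
    exact: continuous_subspaceT.
  - lra.
  - exact: cfi.
rewrite -[f t i 0]subr0; apply: is_deriveB.
by split => //; rewrite -vP derive1E.
Qed.

End matrix_derivatives.

Section concatenation.
Context {R : realType}.

(** The completed sigma-algebra contains the Borel sets. *)
Lemma completed_itv_measurable (i : interval R) :
  (completed_algebra_gen (@lebesgue_measure R)).-sigma.-measurable
    ([set` i] : set R).
Proof.
rewrite g_sigma_completed_algebra_genE.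
exists [set` i]; first exact: measurable_itv.
by exists set0; [exact: negligible_set0|rewrite setU0].
Qed.

Lemma measurable_concat (k : nat) (u : R -> 'cV[R]_k) v a b c :
  a <= b -> b <= c -> lebesgue_measurable_fun `[a, b] u ->
  lebesgue_measurable_fun `[a, c] (fun s => if s <= b then u s else v).
Proof.
move=> ab bc mu _ Y mY.
have -> : `[a, c]%classic `&` (fun s => if s <= b then u s else v) @^-1` Y =
    (`[a, b]%classic `&` u @^-1` Y) `|`
    (`]b, c]%classic `&` (fun=> v) @^-1` Y).
  apply/seteqP; split => s /=; rewrite !in_itv/=.
    move=> [/andP[as_ sc]]; case: leP => sb Ys; [left|right].
      by rewrite as_.
    by rewrite sc.
  move=> [[/andP[as_ sb] Ys]|[/andP[bs sc] Yv]].
    by rewrite as_ sb (le_trans sb bc).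
  by rewrite (le_trans ab (ltW bs)) sc leNgt bs.
apply: measurableU.
  by apply: mu => //; exact: completed_itv_measurable.
have [Yv|nYv] := pselect (Y v).
  have -> : (fun=> v) @^-1` Y = [set: R] by apply/seteqP; split.
  by rewrite setIT; exact: completed_itv_measurable.
have -> : (fun=> v) @^-1` Y = set0 :> set R by apply/seteqP; split.
by rewrite setI0; exact: measurable0.
Qed.

Lemma measurable_constant (k : nat) (i : interval R) (v : 'cV[R]_k) :
  lebesgue_measurable_fun [set` i] (fun=> v).
Proof.
move=> mi Y _; have [Yv|nYv] := pselect (Y v).
  have -> : (fun=> v) @^-1` Y = [set: R] by apply/seteqP; split.
  by rewrite setIT; exact: mi.
have -> : (fun=> v) @^-1` Y = set0 :> set R by apply/seteqP; split.
by rewrite setI0; exact: measurable0.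
Qed.

Lemma ae_neq (a : R) : {ae lebesgue_measure, forall t : R, t != a}.
Proof.
exists [set a]; split; [exact: measurable_set1|exact: lebesgue_measure_set1|].
by move=> t /= /negP; rewrite negbK => /eqP.
Qed.

(** Trajectories defined by cases are locally equal to one of their pieces away
    from the junction. *)
Lemma is_derive_near (V : normedModType R) (f g : R -> V) (t e : R) D : 0 < e ->
  (forall s, `|s - t| < e -> g s = f s) ->
  is_derive (t : R^o) (1 : R^o) f D -> is_derive (t : R^o) (1 : R^o) g D.
Proof.
move=> e0 fg /is_derive_eps h; apply/is_derive_eps => e' e'0.
have [d d0 hd] := h _ e'0; exists (Num.min d e); first by rewrite lt_min d0.
move=> s; rewrite lt_min => /andP[sd se].
by rewrite !fg ?subrr ?normr0//; exact: hd.
Qed.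

Lemma lip_concat (V : normedModType R) (x y : R -> V) a b c :
  x b = y b ->
  (exists C, forall s t, a <= s -> s <= t -> t <= b ->
     `|x t - x s| <= C * (t - s)) ->
  (exists C, forall s t, b <= s -> s <= t -> t <= c ->
     `|y t - y s| <= C * (t - s)) ->
  exists C, forall s t, a <= s -> s <= t -> t <= c ->
    `|(if t <= b then x t else y t) - (if s <= b then x s else y s)|
      <= C * (t - s).
Proof.
move=> xy [C1 h1] [C2 h2]; exists (`|C1| + `|C2|) => s t as_ st tc.
have f1 := ler_norm C1; have f2 := ler_norm C2.
have g1 := normr_ge0 C1; have g2 := normr_ge0 C2.
have [tb|bt] := leP t b.
  rewrite (le_trans st tb); apply: (le_trans (h1 _ _ as_ st tb)).
  by rewrite ler_wpM2r ?subr_ge0//; lra.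
have [sb|bs] := leP s b; last first.
  apply: (le_trans (h2 _ _ (ltW bs) st tc)).
  by rewrite ler_wpM2r ?subr_ge0//; lra.
have -> : y t - x s = (y t - y b) + (x b - x s) by rewrite xy addrA subrK.
apply: (le_trans (ler_normD _ _)).
have k1 := h1 _ _ as_ sb (lexx _); have k2 := h2 _ _ (lexx _) (ltW bt) tc.
have m1 : 0 <= (`|C1| - C1) * (b - s) by rewrite mulr_ge0 ?subr_ge0.
have m2 : 0 <= (`|C2| - C2) * (t - b) by rewrite mulr_ge0 ?subr_ge0// ltW.
have m3 : 0 <= `|C1| * (t - b) by rewrite mulr_ge0 ?subr_ge0// ltW.
have m4 : 0 <= `|C2| * (b - s) by rewrite mulr_ge0 ?subr_ge0.
lra.
Qed.

End concatenation.

(** * The linear system on one time step *)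

Section linear_system.
Context {R : realType} {n m : nat}.
Variables (NX : 'cV[R]_n -> R) (NU : 'cV[R]_m -> R).
Hypotheses (hX : is_norm NX) (hU : is_norm NU).
Variables (t0 tf : R) (A : R -> 'M[R]_n) (B : R -> 'M[R]_(n, m)).
(** The bounds and Lipschitz constants extracted from the [C^1] hypotheses; every
    estimate goes through them. *)
Variables (MA MdA MB MdB : R).
Hypotheses (MA0 : 0 < MA) (MdA0 : 0 <= MdA) (MB0 : 0 <= MB) (MdB0 : 0 <= MdB).
Hypothesis A_le : forall t x, t0 <= t -> t <= tf -> NX (A t *m x) <= MA * NX x.
Hypothesis A_lip : forall s t x, t0 <= s -> s <= t -> t <= tf ->
  NX ((A t - A s) *m x) <= MdA * (t - s) * NX x.
Hypothesis B_le : forall t x, t0 <= t -> t <= tf -> NX (B t *m x) <= MB * NU x.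
Hypothesis B_lip : forall s t x, t0 <= s -> s <= t -> t <= tf ->
  NX ((B t - B s) *m x) <= MdB * (t - s) * NU x.
Variable phi : R -> R -> 'M[R]_n.
Hypothesis phiP : is_transition_matrix A B t0 tf phi.

Section free_solution.
Variables (s0 : R) (p : 'cV[R]_n).
Hypotheses (s0_ge : t0 <= s0) (s0_le : s0 <= tf).
Let y t := phi t s0 *m p.

Lemma phi_ac : abs_continuous s0 tf y.
Proof.
have s0in : s0 \in `[t0, tf] by rewrite in_itv/= s0_ge.
by have [h _ _] := phiP p s0in; exact: ac_sub h.
Qed.

Lemma phi_ae : {ae lebesgue_measure, forall t : R, t \in `[t0, tf] ->
  is_derive (t : R^o) (1 : R^o) y (A t *m y t)}.
Proof.
have s0in : s0 \in `[t0, tf] by rewrite in_itv/= s0_ge.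
have [_ h _] := phiP p s0in; apply: ae_imp h => t h /h.
by rewrite mulmx0 addr0.
Qed.

Lemma phi_start : y s0 = p.
Proof.
have s0in : s0 \in `[t0, tf] by rewrite in_itv/= s0_ge.
by have [_ _] := phiP p s0in.
Qed.

Lemma phi_le t : s0 <= t -> t <= tf -> NX (y t) <= expR (MA * (t - s0)) * NX p.
Proof.
move=> st tt; have := gronwall hX MA0 (lexx 0) phi_ac _ st tt.
rewrite mul0r mul0r addr0 phi_start; apply.
apply: ae_imp phi_ae => u hu; rewrite in_itv/= => /andP[su ut].
exists (A u *m y u); first by apply: hu; rewrite in_itv/= (le_trans s0_ge).
by rewrite addr0 A_le// (le_trans s0_ge).
Qed.

Lemma phi_incr s t : s0 <= s -> s <= t -> t <= tf ->
  NX (y t - y s) <= (expR (MA * (t - s0)) - expR (MA * (s - s0))) * NX p.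
Proof.
move=> ss st tt.
have := @increment_le _ _ _ hX y (expquad MA s0 (NX p) 0 0) _ 0 s t st
  (ac_sub ss tt phi_ac) (is_derive_expquad _ _ _ _ _).
rewrite scaler0 subr0 /expquad => h; rewrite mulrBl.
have -> : expR (MA * (t - s0)) * NX p - expR (MA * (s - s0)) * NX p =
   NX p * expR (MA * (t - s0)) + 0 * t + 0 * t ^+ 2 -
   (NX p * expR (MA * (s - s0)) + 0 * s + 0 * s ^+ 2) by ring.
apply: h => [u su ut|].
  by rewrite mul0r !addr0 !mulr_ge0 ?(nrm_ge0 hX) ?expR_ge0 ?(ltW MA0).
apply: ae_imp phi_ae => u hu; rewrite in_itv/= => /andP[su ut].
have tu : t0 <= u by rewrite (le_trans s0_ge)// (le_trans ss).
have uf : u <= tf by exact: le_trans tt.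
exists (A u *m y u); first by apply: hu; rewrite in_itv/= tu.
rewrite subr0 mul0r !addr0; apply: (le_trans (A_le _ tu uf)).
rewrite mulrCA ler_wpM2l ?(ltW MA0)// mulrC phi_le// (le_trans ss)//.
Qed.

(** Write the difference as [A t (y t - y s) + (A t - A s) y s].  In the second
    term [(t - s) expR (MA * (s - s0))] is at most the increment of the exponential
    divided by [MA], by convexity; hence the factor [MdA / MA + MA]. *)
Lemma phi_velocity s t : s0 <= s -> s <= t -> t <= tf ->
  NX (A t *m y t - A s *m y s) <=
  (MdA / MA + MA) * NX p * (expR (MA * (t - s0)) - expR (MA * (s - s0))).
Proof.
move=> ss st tt.
have -> : A t *m y t - A s *m y s = A t *m (y t - y s) + (A t - A s) *m y s.
  by rewrite mulmxBr mulmxBl addrA subrK.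
apply: (le_trans (nrmD hX _ _)).
have t0s : t0 <= s by exact: le_trans ss.
have h1 := A_le (y t - y s) (le_trans t0s st) tt.
have h2 := A_lip (y s) t0s st tt.
have h3 := ler_wpM2l (ltW MA0) (phi_incr ss st tt).
have h4 := phi_le ss (le_trans st tt).
have ts : 0 <= t - s by lra.
have h5 := ler_wpM2l (mulr_ge0 MdA0 ts) h4.
have h6 := expR_tangent (MA * (s - s0)) (MA * (t - s0)).
have h7 : (t - s) * expR (MA * (s - s0)) <=
    (expR (MA * (t - s0)) - expR (MA * (s - s0))) / MA.
  by rewrite ler_pdivlMr//; lra.
have h8 := ler_wpM2l (mulr_ge0 MdA0 (nrm_ge0 hX p)) h7.
have -> : (MdA / MA + MA) * NX p *
    (expR (MA * (t - s0)) - expR (MA * (s - s0))) =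
  MdA * NX p * ((expR (MA * (t - s0)) - expR (MA * (s - s0))) / MA) +
  MA * ((expR (MA * (t - s0)) - expR (MA * (s - s0))) * NX p) by ring.
lra.
Qed.

(** On both sides of the intermediate time [t] the solution is compared with the
    straight motion whose velocity [A t y t] is the one reached at [t].  With
    weights [1 - l] and [l] the linear terms cancel, and the two majorants combine
    to the convexity defect [l * rfun h - rfun (l * h)], which yields the
    single factor [l] required by the definition of [Gamma]. *)
Lemma phi_chord s1 l : s0 <= s1 -> s1 <= tf -> 0 <= l -> l <= 1 ->
  NX (y (s0 + l * (s1 - s0)) - ((1 - l) *: p + l *: y s1)) <=
  l * (Defs.gamma MA MdA (s1 - s0) * NX p).
Proof.
move=> s01 s1f l0 l1; set t := s0 + l * (s1 - s0).
have s10 : 0 <= s1 - s0 by rewrite subr_ge0.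
have ts0 : s0 <= t by rewrite lerDl mulr_ge0.
have ts1 : t <= s1.
  by rewrite -lerBrDl -[leRHS]mul1r ler_wpM2r.
pose V := A t *m y t.
pose K := (MdA / MA + MA) * NX p.
have K0 : 0 <= K.
  by rewrite mulr_ge0 ?(nrm_ge0 hX)// addr_ge0 ?divr_ge0// ltW.
have first_half : NX (y t - p - (t - s0) *: V) <=
    K * (expR (MA * (t - s0)) * (t - s0) - (expR (MA * (t - s0)) - 1) / MA).
  have := @increment_le _ _ _ hX y
    (expquad MA s0 (- (K / MA)) (K * expR (MA * (t - s0))) 0) _ V s0 t ts0
    (ac_sub (lexx _) (le_trans ts1 s1f) phi_ac) (is_derive_expquad _ _ _ _ _).
  rewrite phi_start => h.
  set r := leRHS.
  have -> : r = expquad MA s0 (- (K / MA)) (K * expR (MA * (t - s0))) 0 t -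
     expquad MA s0 (- (K / MA)) (K * expR (MA * (t - s0))) 0 s0.
    rewrite /r /expquad subrr mulr0 expR0; field; exact: lt0r_neq0.
  have dE u : - (K / MA) * (MA * expR (MA * (u - s0))) +
      K * expR (MA * (t - s0)) + 0 * (2 * u) =
      K * (expR (MA * (t - s0)) - expR (MA * (u - s0))).
    by field; exact: lt0r_neq0.
  apply: h => [u su ut|].
    rewrite dE mulr_ge0// subr_ge0 ler_expR ler_wpM2l ?(ltW MA0)//.
    by rewrite lerD2r.
  apply: ae_imp phi_ae => u hu; rewrite in_itv/= => /andP[su ut].
  have uf : u <= tf by rewrite (le_trans ut)// (le_trans ts1).
  exists (A u *m y u); first by apply: hu; rewrite in_itv/= (le_trans s0_ge).
  by rewrite dE (nrmC hX) phi_velocity// (le_trans ts1).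
have second_half : NX (y s1 - y t - (s1 - t) *: V) <=
    K * ((expR (MA * (s1 - s0)) - expR (MA * (t - s0))) / MA -
         expR (MA * (t - s0)) * (s1 - t)).
  have := @increment_le _ _ _ hX y
    (expquad MA s0 (K / MA) (- (K * expR (MA * (t - s0)))) 0) _ V t s1 ts1
    (ac_sub ts0 s1f phi_ac) (is_derive_expquad _ _ _ _ _) => h.
  set r := leRHS.
  have -> : r = expquad MA s0 (K / MA) (- (K * expR (MA * (t - s0)))) 0 s1 -
     expquad MA s0 (K / MA) (- (K * expR (MA * (t - s0)))) 0 t.
    rewrite /r /expquad; field; exact: lt0r_neq0.
  have dE u : K / MA * (MA * expR (MA * (u - s0))) -
      K * expR (MA * (t - s0)) + 0 * (2 * u) =
      K * (expR (MA * (u - s0)) - expR (MA * (t - s0))).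
    by field; exact: lt0r_neq0.
  apply: h => [u su ut|].
    rewrite dE mulr_ge0// subr_ge0 ler_expR ler_wpM2l ?(ltW MA0)//.
    by rewrite lerD2r.
  apply: ae_imp phi_ae => u hu; rewrite in_itv/= => /andP[su ut].
  have uf : u <= tf by rewrite (le_trans ut).
  have tu : t0 <= u by rewrite (le_trans s0_ge)// (le_trans ts0).
  exists (A u *m y u); first by apply: hu; rewrite in_itv/= tu.
  by rewrite dE phi_velocity.
have tE : t - s0 = l * (s1 - s0) by rewrite /t; ring.
have t1E : s1 - t = (1 - l) * (s1 - s0) by rewrite /t; ring.
have -> : y t - ((1 - l) *: p + l *: y s1) =
    (1 - l) *: (y t - p - (t - s0) *: V) - l *: (y s1 - y t - (s1 - t) *: V).
  by rewrite tE t1E; apply/matrixP => i j; rewrite !mxE; ring.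
apply: (le_trans (nrmB hX _ _)); rewrite !(nrmZp hX)//; last by lra.
have l2 : 0 <= 1 - l by lra.
have h1 := ler_wpM2l l2 first_half; have h2 := ler_wpM2l l0 second_half.
apply: (le_trans (lerD h1 h2)).
have r0 : 0 <= K / MA * rfun MA (t - s0).
  by rewrite mulr_ge0 ?rfun_ge0// divr_ge0// ltW.
rewrite -[leRHS]subr0; apply: (@le_trans _ _ (l * (Defs.gamma MA MdA (s1 - s0) *
  NX p) - K / MA * rfun MA (t - s0))); last by rewrite lerD2l lerN2.
rewrite le_eqVlt; apply/orP; left; apply/eqP.
rewrite /Defs.gamma /rfun /K !(mulrC _ MA) t1E tE; field; exact: lt0r_neq0.
Qed.

End free_solution.

Section controlled_solution.
Variables (s0 t : R) (x : R -> 'cV[R]_n) (u : R -> 'cV[R]_m).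
Variables (K : set 'cV[R]_m) (rho : R).
Hypotheses (s0_ge : t0 <= s0) (st : s0 <= t) (tt : t <= tf).
Hypotheses (x_ac : abs_continuous s0 t x).
Hypothesis x_ae : {ae lebesgue_measure, forall s : R, s \in `[s0, t] ->
  is_derive (s : R^o) (1 : R^o) x (A s *m x s + B s *m u s)}.
Hypothesis uK : forall s, s \in `[s0, t] -> K (u s).
Hypothesis K_le : forall v, K v -> NU v <= rho.
Let w s := x s - phi s s0 *m x s0.
Let s0tf : s0 <= tf. Proof. exact: le_trans tt. Qed.

Lemma rho_ge0 : 0 <= rho.
Proof.
have s0in : s0 \in `[s0, t] by rewrite in_itv/= lexx.
by apply: le_trans (K_le (uK s0in)); exact: (nrm_ge0 hU).
Qed.

Lemma control_ac : abs_continuous s0 t w.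
Proof.
by apply: ac_subtract => //; apply: ac_sub (phi_ac _ s0_ge s0tf).
Qed.

Lemma control_ae : {ae lebesgue_measure, forall s : R, s \in `[s0, t] ->
  is_derive (s : R^o) (1 : R^o) w (A s *m w s + B s *m u s)}.
Proof.
apply: ae_imp2 x_ae (phi_ae (x s0) s0_ge s0tf) => s h1 h2 sin.
have {}h1 := h1 sin; have {}h2 : is_derive (s : R^o) (1 : R^o)
    (fun s => phi s s0 *m x s0) (A s *m (phi s s0 *m x s0)).
  apply: h2; move: sin; rewrite !in_itv/= => /andP[ss sn].
  by rewrite (le_trans s0_ge)// (le_trans sn).
rewrite /w mulmxBr addrAC; exact: is_deriveB.
Qed.

Lemma control_le s : s0 <= s -> s <= t ->
  NX (w s) <= MB * rho / MA * (expR (MA * (s - s0)) - 1).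
Proof.
move=> ss sn; have c0 : 0 <= MB * rho by rewrite mulr_ge0 ?rho_ge0.
have := gronwall hX MA0 c0 control_ac _ ss sn.
have -> : w s0 = 0 by rewrite /w (phi_start _ s0_ge s0tf) subrr.
rewrite (nrm0 hX) mulr0 add0r; apply.
apply: ae_imp control_ae => v h vin; exists (A v *m w v + B v *m u v).
  exact: h.
move: (vin); rewrite in_itv/= => /andP[sv vt].
have tv : t0 <= v by exact: le_trans sv.
have vf : v <= tf by exact: le_trans tt.
apply: (le_trans (nrmD hX _ _)); apply: lerD; first exact: A_le.
by apply: (le_trans (B_le _ tv vf)); rewrite ler_wpM2l//; apply: K_le; exact: uK.
Qed.

(** In [w' = A w + B u] the first term is bounded by [control_le], and [B] is
    close to [B s1]; the mean value inclusion with [K] replaced by its image under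
    [B s1] averages the control.  The majorant integrates to
    [MB rho rfun (l h) / MA + MdB rho l h^2 (1 - l / 2)], which is at most
    [l alpha + l (1 - l) beta]. *)
Lemma control_step s1 l : t <= s1 -> s1 <= tf -> 0 <= l -> l <= 1 ->
  t - s0 = l * (s1 - s0) -> compact K -> convexS K ->
  exists2 v, K v & NX (w t - (t - s0) *: (B s1 *m v)) <=
    l * (alpha rho MA MB MdB (s1 - s0) +
         (1 - l) * Defs.beta rho MdB (s1 - s0)).
Proof.
move=> ts1 s1f l0 l1 tE cK vK.
have s10 : 0 <= s1 - s0 by rewrite subr_ge0 (le_trans st).
pose K' := [set B s1 *m v | v in K].
have cK' : compact K'.
  apply: continuous_compact => //; apply: continuous_subspaceT.
  apply: (@cont_of_lip _ _ _ _ (m%:R * `|B s1|)) => v v'.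
  by rewrite -mulmxBr mulmx_sup_le.
have vK' : convexS K'.
  move=> _ _ a a0 a1 [v Kv <-] [v' Kv' <-].
  exists (a *: v + (1 - a) *: v'); first exact: vK.
  by rewrite mulmxDr -!scalemxAr.
have K'0 : K' !=set0.
  by exists (B s1 *m u s0), (u s0) => //; apply: uK; rewrite in_itv/= lexx.
have rho0 := rho_ge0.
pose c1 := MB * rho / MA; pose c2 := MdB * rho * s1 - MB * rho.
pose c3 := - (MdB * rho / 2).
have dE v : c1 * (MA * expR (MA * (v - s0))) + c2 + c3 * (2 * v) =
    MA * (c1 * (expR (MA * (v - s0)) - 1)) + MdB * (s1 - v) * rho.
  by rewrite /c1 /c2 /c3; field; exact: lt0r_neq0.
have [_ [v Kv <-] hv] : exists2 v, K' v & NX (w t - w s0 - (t - s0) *: v) <=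
    expquad MA s0 c1 c2 c3 t - expquad MA s0 c1 c2 c3 s0.
  apply: (increment_hull hX st cK' vK' K'0 control_ac
    (is_derive_expquad MA s0 c1 c2 c3)).
    move=> v sv vt; have vs1 := le_trans vt ts1.
    rewrite dE addr_ge0// mulr_ge0 ?(ltW MA0)//; last first.
      by rewrite mulr_ge0 ?subr_ge0.
    rewrite mulr_ge0 ?divr_ge0 ?mulr_ge0 ?(ltW MA0)//.
    by rewrite subr_ge0 -[leLHS]expR0 ler_expR mulr_ge0 ?subr_ge0 ?(ltW MA0).
  apply: ae_imp control_ae => v h vin; exists (A v *m w v + B v *m u v).
  exists (B s1 *m u v); split; first exact: h.
    by exists (u v) => //; exact: uK.
  move: (vin); rewrite in_itv/= => /andP[sv vt].
  have tv : t0 <= v by exact: le_trans sv.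
  have vs1 : v <= s1 by exact: le_trans ts1.
  rewrite dE -addrA -mulmxBl; apply: (le_trans (nrmD hX _ _)); apply: lerD.
    apply: (le_trans (A_le _ tv (le_trans vs1 s1f))).
    by rewrite ler_wpM2l ?(ltW MA0)// control_le.
  rewrite -(nrmN hX) -mulNmx opprB; apply: (le_trans (B_lip _ tv vs1 s1f)).
  rewrite ler_wpM2l ?mulr_ge0 ?subr_ge0//; apply: K_le; exact: uK.
exists v => //.
have w0 : w s0 = 0 by rewrite /w (phi_start _ s0_ge s0tf) subrr.
rewrite w0 subr0 in hv; apply: (le_trans hv).
set h := s1 - s0 in s10 tE *.
have -> : expquad MA s0 c1 c2 c3 t - expquad MA s0 c1 c2 c3 s0 =
    MB * rho / MA * rfun MA (l * h) + MdB * rho * (l * h) * (h - l * h / 2).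
  have s1E : s1 = h + s0 by rewrite /h subrK.
  have tE' : t = l * h + s0 by rewrite -tE subrK.
  rewrite /expquad /rfun /c1 /c2 /c3 tE' s1E subrr mulr0 expR0 addrK.
  by rewrite (mulrC _ MA); field; exact: lt0r_neq0.
have h1 := rfun_scale_le MA h l0 l1.
have h2 := rfun_ge_sqr (ltW MA0) s10.
have c0 : 0 <= MB * rho / MA by rewrite divr_ge0 ?mulr_ge0 ?(ltW MA0).
have h3 := ler_wpM2l c0 h1.
have h4 : h ^+ 2 / 2 <= rfun MA h / MA ^+ 2.
  by rewrite ler_pdivlMr ?exprn_gt0//; apply: le_trans h2; rewrite exprMn; lra.
have h5 := ler_wpM2l (mulr_ge0 l0 (mulr_ge0 MdB0 rho0)) h4.
have h6 : l * (MdB * rho) * h ^+ 2 * (1 - l / 2) <=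
    l * (MdB * rho) * h ^+ 2 * (1 / 2 + (1 - l)).
  by rewrite ler_wpM2l ?mulr_ge0 ?exprn_ge0//; lra.
rewrite /alpha /Defs.beta.
have -> : l * (rfun MA h * rho * ((MdB + MA * MB) / MA ^+ 2) +
    (1 - l) * (h ^+ 2 * MdB * rho)) = MB * rho / MA * (l * rfun MA h) +
    l * (MdB * rho) * (rfun MA h / MA ^+ 2) +
    l * (MdB * rho) * h ^+ 2 * (1 - l).
  by field; exact: lt0r_neq0.
lra.
Qed.

End controlled_solution.

(** * Existence of trajectories with constant control *)

Section constant_control.
Variables (s0 s1 : R).
Hypotheses (s0_ge : t0 <= s0) (s01 : s0 <= s1) (s1_le : s1 <= tf).
Hypothesis short : expR (MA * (s1 - s0)) <= 3 / 2.

Let exp_le t : t <= s1 -> expR (MA * (t - s0)) <= 3 / 2.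
Proof.
move=> ts1; apply: le_trans short; rewrite ler_expR ler_wpM2l ?(ltW MA0)//.
by rewrite lerD2r.
Qed.

Let s0_le : s0 <= tf. Proof. exact: le_trans s1_le. Qed.

(** On a short step [phi t s0] differs from the identity by at most one half. *)
Lemma phi_expansive t q : s0 <= t -> t <= s1 -> NX q <= 2 * NX (phi t s0 *m q).
Proof.
move=> st ts1.
have := phi_incr q s0_ge s0_le (lexx s0) st (le_trans ts1 s1_le).
rewrite phi_start// subrr mulr0 expR0.
have := exp_le ts1; have := nrm_ge0 hX q.
have := nrm_rev hX q (phi t s0 *m q); rewrite (nrmC hX q); nra.
Qed.

Lemma phi_unit t : s0 <= t -> t <= s1 -> phi t s0 \in unitmx.
Proof.
move=> st ts1; rewrite -unitmx_tr -row_free_unit; apply: inj_row_free => v.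
move/(congr1 trmx); rewrite trmx_mul trmxK trmx0 => h.
have := phi_expansive v^T st ts1; rewrite h (nrm0 hX) mulr0 => h0.
apply/trmx_inj; rewrite trmx0; apply: (nrm0_eq0 hX).
by apply/le_anti; rewrite h0 (nrm_ge0 hX).
Qed.

(** The columns are solutions, and finitely many null sets are discarded at once. *)
Lemma phi_ae_mx : {ae lebesgue_measure, forall t : R, t \in `[t0, tf] ->
  is_derive (t : R^o) (1 : R^o) (fun t => phi t s0) (A t *m phi t s0)}.
Proof.
have h (j : nat) : {ae lebesgue_measure, forall t : R, t \in `[t0, tf] ->
   forall (hj : (j < n)%N) i, is_derive (t : R^o) (1 : R^o)
     (fun t => phi t s0 i (Ordinal hj) : R^o)
     ((A t *m phi t s0) i (Ordinal hj))}.
  have [hj|nj] := pselect (is_true (j < n)%N); last first.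
    by apply: aeW => t _ hj.
  apply: ae_imp (phi_ae (delta_mx (Ordinal hj) 0) s0_ge s0_le) => t ht tin.
  move=> hj' i; have := ht tin => /is_derive_mxP/(_ i 0).
  have E (M : 'M[R]_n) : (M *m delta_mx (Ordinal hj) 0 : 'cV_n) i 0 =
      M i (Ordinal hj').
    by rewrite -colE mxE; congr (M i _); exact: val_inj.
  by rewrite mulmxA E; congr is_derive; apply/funext => u; rewrite E.
apply: ae_imp (ae_foralln h) => t ht tin; apply/is_derive_mxP => i j.
by have := ht j tin (ltn_ord j) i; congr is_derive;
  [apply/funext => u; congr (phi u s0 i _)|congr (_ i _)]; exact: val_inj.
Qed.

Variables (p : 'cV[R]_n) (v : 'cV[R]_m).

Let F t := invmx (phi t s0) *m (B t *m v).

Lemma phi_forcing t : s0 <= t -> t <= s1 -> phi t s0 *m F t = B t *m v.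
Proof. by move=> st ts; rewrite /F mulmxA mulmxV ?phi_unit// mul1mx. Qed.

Lemma forcing_le t : s0 <= t -> t <= s1 -> NX (F t) <= 2 * (MB * NU v).
Proof.
move=> st ts; apply: (le_trans (phi_expansive _ st ts)); rewrite phi_forcing//.
by rewrite ler_wpM2l// B_le// ?(le_trans s0_ge)// (le_trans ts).
Qed.

(** Apply [phi t s0] to the difference: [phi t s0 (F t - F s)] involves only
    increments of [B] and of [phi], and [phi_expansive] bounds
    [F t - F s] by it. *)
Lemma forcing_lip s t : s0 <= s -> s <= t -> t <= s1 ->
  NX (F t - F s) <=
  2 * (MdB * NU v + 3 / 2 * MA * (2 * (MB * NU v))) * (t - s).
Proof.
move=> ss st ts; have s0t := le_trans ss st; have ss1 := le_trans st ts.
apply: (le_trans (phi_expansive _ s0t ts)).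
have -> : phi t s0 *m (F t - F s) =
    (B t - B s) *m v - (phi t s0 *m F s - phi s s0 *m F s).
  rewrite mulmxBr !phi_forcing// mulmxBl opprB addrA; congr (_ - _).
  by rewrite subrK.
rewrite -mulrA ler_wpM2l//; apply: (le_trans (nrmB hX _ _)); rewrite mulrDl.
apply: lerD.
  by rewrite mulrAC B_lip// ?(le_trans s0_ge)// (le_trans ts).
apply: (le_trans (phi_incr (F s) s0_ge s0_le ss st
  (le_trans ts s1_le))).
have h1 := expR_tangent (MA * (t - s0)) (MA * (s - s0)).
have h2 := exp_le ts.
have ts0 : 0 <= t - s by rewrite subr_ge0.
have h3 : expR (MA * (t - s0)) - expR (MA * (s - s0)) <= 3 / 2 * MA * (t - s).
  have := ler_wpM2r (mulr_ge0 (ltW MA0) ts0) h2; lra.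
rewrite mulrAC; apply: ler_pM => //.
- rewrite subr_ge0 ler_expR ler_wpM2l ?(ltW MA0)//; lra.
- exact: (nrm_ge0 hX).
- exact: forcing_le.
Qed.
(** Variation of constants: [phi t s0 (p + Q t)], where [Q] is an antiderivative of
    [(phi t s0)^-1 B t v].  The inverse exists because [phi t s0] is close to the
    identity on a short step. *)
Lemma constant_control_solution : exists x : R -> 'cV[R]_n,
  [/\ x s0 = p,
      {ae lebesgue_measure, forall t : R, t \in `[s0, s1] ->
         is_derive (t : R^o) (1 : R^o) x (A t *m x t + B t *m v)}
    & exists C, forall s t, s0 <= s -> s <= t -> t <= s1 ->
        `|x t - x s| <= C * (t - s)].
Proof.
have [c c0 hc] := sup_le_nrm hX.
have [C C0 hC] := nrm_le_sup hX.
set L := 2 * (MdB * NU v + 3 / 2 * MA * (2 * (MB * NU v))).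
have L0 : 0 <= L.
  by rewrite /L !(mulr_ge0, addr_ge0) ?(nrm_ge0 hU) ?(ltW MA0).
pose G t := F (clamp s0 s1 t).
have cG : continuous G.
  apply: (@cont_of_lip _ R^o _ _ (c * L)) => s t.
  wlog st : s t / s <= t.
    move=> hw; have [/hw //|/ltW /hw] := leP s t.
    by rewrite distrC (distrC t).
  apply: (le_trans (hc _)); rewrite -mulrA ler_wpM2l ?(ltW c0)//.
  have [a1 b1] := clamp_in s s01; have [a2 b2] := clamp_in t s01.
  have cst_ : clamp s0 s1 s <= clamp s0 s1 t.
    by rewrite /clamp le_max2// le_min2.
  rewrite (nrmC hX) /G; apply: (le_trans (forcing_lip a1 cst_ b2)).
  rewrite ler_wpM2l//; apply: (le_trans (ler_norm _)).
  by rewrite [leRHS]distrC; exact: clamp_dist.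
have [Q Q0 dQ] := antiderivative s0 cG.
have Q_lip s t : s0 <= s -> s <= t -> t <= s1 ->
    NX (Q t - Q s) <= 2 * (MB * NU v) * (t - s).
  move=> ss st ts; apply: (lip_of_derivative hX) => // u su ut.
  exists (G u).
    by have [? ?] := clamp_in u s01; exact: forcing_le.
  move=> e e0; have [d d0 hd] := is_derive_nrm hX (dQ u (le_trans ss su)) e0.
  by exists d => // s' _ _; exact: hd.
exists (fun t => phi t s0 *m (p + Q t)); split.
- by rewrite Q0 addr0 phi_start.
- apply: ae_imp phi_ae_mx => t ht tin; have := tin.
  rewrite in_itv/= => /andP[st ts].
  have dphi : is_derive (t : R^o) (1 : R^o) (fun t => phi t s0) (A t *m phi t s0).
    by apply: ht; rewrite in_itv/= (le_trans s0_ge)// (le_trans ts).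
  have dpQ : is_derive (t : R^o) (1 : R^o) (fun t => p + Q t) (G t).
    by rewrite -[G t]add0r; apply: is_deriveD; exact: dQ.
  have := is_derive_mulmx dphi dpQ.
  by rewrite /G (clamp_id st ts) phi_forcing// -mulmxA.
have NU0 := nrm_ge0 hU v.
pose D := NX p + 2 * (MB * NU v) * (s1 - s0).
exists (c * (3 / 2 * (2 * (MB * NU v)) + 3 / 2 * MA * D)) => s t ss st ts.
have s0t := le_trans ss st; have ss1 := le_trans st ts.
have t_tf := le_trans ts s1_le.
apply: (le_trans (hc _)); rewrite -[leRHS]mulrA ler_wpM2l ?(ltW c0)//.
have -> : phi t s0 *m (p + Q t) - phi s s0 *m (p + Q s) =
    phi t s0 *m (Q t - Q s) + (phi t s0 *m (p + Q s) - phi s s0 *m (p + Q s)).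
  rewrite addrA -mulmxDr; congr (_ *m _ - _).
  by rewrite [RHS]addrCA subrK.
apply: (le_trans (nrmD hX _ _)); rewrite mulrDl; apply: lerD.
  apply: (le_trans (phi_le _ s0_ge s0_le s0t t_tf)).
  rewrite -[leRHS]mulrA; apply: ler_pM; rewrite ?expR_ge0 ?(nrm_ge0 hX)//.
    exact: exp_le.
  exact: Q_lip.
apply: (le_trans (phi_incr _ s0_ge s0_le ss st t_tf)).
have h1 := expR_tangent (MA * (t - s0)) (MA * (s - s0)).
have h2 := exp_le ts.
have ts0 : 0 <= t - s by rewrite subr_ge0.
have h3 : expR (MA * (t - s0)) - expR (MA * (s - s0)) <= 3 / 2 * MA * (t - s).
  have := ler_wpM2r (mulr_ge0 (ltW MA0) ts0) h2; lra.
rewrite mulrAC; apply: ler_pM => //.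
- rewrite subr_ge0 ler_expR ler_wpM2l ?(ltW MA0)//; lra.
- exact: (nrm_ge0 hX).
apply: (le_trans (nrmD hX _ _)); rewrite lerD2l.
have := Q_lip s0 s (lexx _) ss ss1; rewrite Q0 subr0 => h; apply: (le_trans h).
rewrite ler_wpM2l ?mulr_ge0// lerD2r//.
Qed.

End constant_control.

(** * Inclusion of the reachable tube *)

Section over_approximation.
Variables (X0 : set 'cV[R]_n) (U : set 'cV[R]_m).
Hypotheses (t0_lt_tf : t0 < tf).
Hypotheses (X0_ne : X0 !=set0) (X0_compact : compact X0) (X0_convex : convexS X0).
Hypotheses (U_ne : U !=set0) (U_compact : compact U) (U_convex : convexS U).
Variables (phit : R -> R -> 'M[R]_n) (theta : R -> R).
Hypothesis theta_ge0 : forall h, 0 <= h -> 0 <= theta h.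
Hypothesis phit_le : forall t s x, t0 <= s -> s <= t -> t <= tf ->
  NX ((phi t s - phit t s) *m x) <= theta (t - s) * NX x.

Let rho := set_norm NU U.

Lemma U_le v : U v -> NU v <= rho.
Proof.
by have [M hM] := compact_bounded_by hU U_compact; exact: set_norm_ub hM.
Qed.

Lemma rhoU_ge0 : 0 <= rho. Proof. exact: (set_norm_ge0 hU). Qed.

(** [Ct] is the quadratic constant of [theta] and the other constants do not depend
    on the mesh: [C1] is the growth rate in both discrete Gronwall estimates, [Rm]
    bounds the radii of the sets [Omega], [C3 * h ^+ 2] bounds their error radii,
    [C4 * h] the tracking error, [C5 * h] and [C6 * h] the distances of the next
    [Omega] and [Gamma] from the present [Omega]. *)
Variable Ct : R.
Hypothesis Ct_ge0 : 0 <= Ct.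
Let L := tf - t0.
Let EL := expR (L * MA).
Let Ca := EL * rho * (MdB + MA * MB).
Let C1 := MA * EL + 2 * (Ct * L).
Let C2 := MB * rho + Ca * L.
Let Rm := expR (C1 * L) * (set_norm NX X0 + C2 * L).
Let C3 := Ca + Ct * Rm.
Let C4 := expR (C1 * L) * (2 * C3 * L).
Let C5 := MA * EL * Rm + Ct * L * Rm + MB * rho + C3 * L.
Let C6 := C5 + (L * MdB * rho + L * MA ^+ 2 * EL * (1 + MdA / MA ^+ 2) * Rm).

Let L_gt0 : 0 < L. Proof. by rewrite subr_gt0. Qed.
Let L_ge0 : 0 <= L := ltW L_gt0.
Let EL_ge0 : 0 <= EL. Proof. exact: expR_ge0. Qed.
Let MA_ge0 : 0 <= MA := ltW MA0.

Let Ca_ge0 : 0 <= Ca.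
Proof.
by apply: mulr_ge0 (mulr_ge0 _ rhoU_ge0) (addr_ge0 MdB0 (mulr_ge0 _ MB0)).
Qed.

Let C1_ge0 : 0 <= C1.
Proof.
apply: addr_ge0; first exact: mulr_ge0.
by apply: mulr_ge0 => //; exact: mulr_ge0.
Qed.

Let C2_ge0 : 0 <= C2.
Proof. exact: addr_ge0 (mulr_ge0 MB0 rhoU_ge0) (mulr_ge0 Ca_ge0 L_ge0). Qed.

Let Rm_ge0 : 0 <= Rm.
Proof.
apply: mulr_ge0; first exact: expR_ge0.
exact: addr_ge0 (set_norm_ge0 hX _) (mulr_ge0 C2_ge0 L_ge0).
Qed.

Let C3_ge0 : 0 <= C3.
Proof. exact: addr_ge0 Ca_ge0 (mulr_ge0 Ct_ge0 Rm_ge0). Qed.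

Let C4_ge0 : 0 <= C4.
Proof.
apply: mulr_ge0; first exact: expR_ge0.
by apply: mulr_ge0 L_ge0; exact: mulr_ge0.
Qed.

Let C5_ge0 : 0 <= C5.
Proof.
apply: addr_ge0 (mulr_ge0 C3_ge0 L_ge0); apply: addr_ge0 (mulr_ge0 MB0 rhoU_ge0).
apply: addr_ge0 (mulr_ge0 (mulr_ge0 Ct_ge0 L_ge0) Rm_ge0).
exact: mulr_ge0 (mulr_ge0 MA_ge0 EL_ge0) Rm_ge0.
Qed.

Let C6_ge0 : 0 <= C6.
Proof.
apply: addr_ge0 C5_ge0 _; apply: addr_ge0.
  exact: mulr_ge0 (mulr_ge0 L_ge0 MdB0) rhoU_ge0.
apply: mulr_ge0 Rm_ge0; apply: mulr_ge0.
  by apply: mulr_ge0 EL_ge0; apply: mulr_ge0 L_ge0 _; exact: exprn_ge0.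
by apply: addr_ge0 => //; rewrite divr_ge0 ?exprn_ge0.
Qed.

Section fixed_mesh.
Variable N : nat.
Hypothesis N_gt0 : (0 < N)%N.

Let h := Defs.step t0 tf N.
Let tn := node t0 tf N.
Let Om := Omega NX NU t0 tf B X0 U MA MB MdB phit theta N.
Let err i := alpha rho MA MB MdB h + theta h * set_norm NX (Om i).

Lemma step_gt0 : 0 < h.
Proof. by rewrite /h /Defs.step divr_gt0 ?subr_gt0// ltr0n. Qed.

Lemma node0 : tn 0 = t0. Proof. by rewrite /tn /node mul0r addr0. Qed.

Lemma nodeN : tn N = tf.
Proof.
by rewrite /tn /node /Defs.step mulrC divfK ?subrKC// pnatr_eq0 -lt0n.
Qed.

Lemma nodeS i : tn i.+1 = tn i + h.
Proof. by rewrite /tn /node -addrA -natr1 mulrDl mul1r. Qed.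

Lemma node_le i j : (i <= j)%N -> tn i <= tn j.
Proof. by move=> ij; rewrite lerD2l ler_wpM2r ?(ltW step_gt0)// ler_nat. Qed.

Lemma node_ge i : t0 <= tn i.
Proof. by rewrite -node0; exact: node_le. Qed.

Lemma node_tf i : (i <= N)%N -> tn i <= tf.
Proof. by rewrite -nodeN; exact: node_le. Qed.

Lemma alpha_ge0 : 0 <= alpha rho MA MB MdB h.
Proof.
rewrite /alpha !mulr_ge0 ?rfun_ge0 ?rhoU_ge0 ?invr_ge0 ?exprn_ge0 ?(ltW MA0)//.
by rewrite addr_ge0 ?mulr_ge0 ?(ltW MA0).
Qed.

Lemma err_ge0 i : 0 <= err i.
Proof.
rewrite addr_ge0 ?alpha_ge0// mulr_ge0 ?(set_norm_ge0 hX)//.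
exact: theta_ge0 (ltW step_gt0).
Qed.

Lemma OmegaSP i z : Om i.+1 z <-> exists y v,
  [/\ Om i y, U v & NX (z - (phit (tn i.+1) (tn i) *m y +
                             h *: (B (tn i.+1) *m v))) <= err i].
Proof.
split.
  move=> [_ [_ [y Oy <-] [_ [_ [v Uv <-] <-] <-]]] [_ [b Bb <-] <-].
  exists y, v; split => //; rewrite addrC addKr.
  by apply/(scale_ballP hX _ (err_ge0 i)); exists b.
move=> [y [v [Oy Uv hz]]].
exists (phit (tn i.+1) (tn i) *m y + h *: (B (tn i.+1) *m v)).
  exists (phit (tn i.+1) (tn i) *m y); first by exists y.
  exists (h *: (B (tn i.+1) *m v)) => //.
  by exists (B (tn i.+1) *m v) => //; exists v.
exists (z - (phit (tn i.+1) (tn i) *m y + h *: (B (tn i.+1) *m v))).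
  exact/(scale_ballP hX _ (err_ge0 i)).
by rewrite subrKC.
Qed.

Lemma Omega_ne i : Om i !=set0.
Proof.
elim: i => [//|i [y Oy]]; have [v Uv] := U_ne.
exists (phit (tn i.+1) (tn i) *m y + h *: (B (tn i.+1) *m v)).
by apply/OmegaSP; exists y, v; rewrite subrr (nrm0 hX) err_ge0.
Qed.

Lemma Omega_convex i : convexS (Om i).
Proof.
elim: i => [//|i IH] z z' a a0 a1 /OmegaSP[y [v [Oy Uv hz]]].
move=> /OmegaSP[y' [v' [Oy' Uv' hz']]]; apply/OmegaSP.
have a2 : 0 <= 1 - a by rewrite subr_ge0.
exists (a *: y + (1 - a) *: y'), (a *: v + (1 - a) *: v').
split; [exact: IH|exact: U_convex|].
set P := phit _ _ in hz hz' *; set Q := B _ in hz hz' *.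
have -> : a *: z + (1 - a) *: z' - (P *m (a *: y + (1 - a) *: y') +
    h *: (Q *m (a *: v + (1 - a) *: v'))) =
    a *: (z - (P *m y + h *: (Q *m v))) +
    (1 - a) *: (z' - (P *m y' + h *: (Q *m v'))).
  rewrite !mulmxDr -!scalemxAr; apply/matrixP => r c; rewrite !mxE; ring.
apply: (le_trans (nrmD hX _ _)); rewrite !(nrmZp hX)//.
have := ler_wpM2l a0 hz; have := ler_wpM2l a2 hz'; lra.
Qed.

Lemma Omega_bounded i : exists M, bounded_by NX (Om i) M.
Proof.
elim: i => [|i [M hM]]; first exact: (compact_bounded_by hX).
exists (opnorm NX NX (phit (tn i.+1) (tn i)) * M +
  h * (opnorm NU NX (B (tn i.+1)) * rho) + err i).
move=> z /OmegaSP[y [v [Oy Uv hz]]].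
apply: (le_trans (nrm_rev hX z (phit (tn i.+1) (tn i) *m y +
                                h *: (B (tn i.+1) *m v)))).
rewrite addrC; apply: lerD => //; apply: (le_trans (nrmD hX _ _)).
apply: lerD.
  apply: (le_trans (opnorm_le hX hX _ _)).
  by rewrite ler_wpM2l ?(opnorm_ge0 hX hX)//; exact: hM.
rewrite (nrmZp hX) ?(ltW step_gt0)// ler_wpM2l ?(ltW step_gt0)//.
apply: (le_trans (opnorm_le hX hU _ _)).
by rewrite ler_wpM2l ?(opnorm_ge0 hX hU)// U_le.
Qed.

Lemma Omega_le i y : Om i y -> NX y <= set_norm NX (Om i).
Proof. have [M hM] := Omega_bounded i; exact: set_norm_ub hM. Qed.

Section trajectory.
Variables (t : R) (x : R -> 'cV[R]_n) (u : R -> 'cV[R]_m).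
Hypotheses (t_le : t <= tf) (x0 : X0 (x t0)).
Hypothesis x_ac : abs_continuous t0 t x.
Hypothesis x_ae : {ae lebesgue_measure, forall s : R, s \in `[t0, t] ->
  is_derive (s : R^o) (1 : R^o) x (A s *m x s + B s *m u s)}.
Hypothesis uU : forall s, s \in `[t0, t] -> U (u s).

(** Kept until the end of the step, the constant control produced here leads to
    a point of [Om i.+1]. *)
Lemma trajectory_step i s l : (i < N)%N -> Om i (x (tn i)) ->
  tn i <= s -> s <= t -> 0 <= l -> l <= 1 -> s = tn i + l * h ->
  exists2 v, U v &
    NX (x s - phi s (tn i) *m x (tn i) - (l * h) *: (B (tn i.+1) *m v)) <=
    l * (alpha rho MA MB MdB h + (1 - l) * Defs.beta rho MdB h).
Proof.
move=> iN Oi is_ st l0 l1 sE.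
have hE : tn i.+1 - tn i = h by rewrite nodeS addrAC subrr add0r.
have sE' : s - tn i = l * h by rewrite sE addrAC subrr add0r.
have ss1 : s <= tn i.+1.
  by rewrite nodeS sE lerD2l ler_piMl// ltW// step_gt0.
have := @control_step (tn i) s x u U rho (node_ge i) is_ (le_trans st t_le)
  (ac_sub (node_ge i) st x_ac) _ _ U_le (tn i.+1) l ss1 (node_tf iN) l0 l1.
rewrite hE sE' => H; apply: H => //.
- apply: ae_imp x_ae => r hr; rewrite in_itv/= => /andP[r1 r2]; apply: hr.
  by rewrite in_itv/= (le_trans (node_ge i))// (le_trans r2).
- move=> r; rewrite in_itv/= => /andP[r1 r2]; apply: uU.
  by rewrite in_itv/= (le_trans (node_ge i))// (le_trans r2).
Qed.

(** The radius of [Om i.+1] accounts for the error [alpha] of the constant control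
    and for the replacement of [phi] by [phit]. *)
Lemma constant_control_Omega i y v e : (i < N)%N -> Om i y -> U v ->
  NX e <= alpha rho MA MB MdB h ->
  Om i.+1 (phi (tn i.+1) (tn i) *m y + h *: (B (tn i.+1) *m v) + e).
Proof.
move=> iN Oy Uv he; apply/OmegaSP; exists y, v; split => //.
set P := phit _ _; set Q := phi _ _; set b := h *: _.
have -> : Q *m y + b + e - (P *m y + b) = e + (Q - P) *m y.
  by rewrite mulmxBl; apply/matrixP => r c; rewrite !mxE; ring.
apply: (le_trans (nrmD hX _ _)); apply: lerD => //.
have := phit_le y (node_ge i) (node_le (leqnSn i)) (node_tf iN).
have -> : tn i.+1 - tn i = h by rewrite nodeS addrAC subrr add0r.
move=> h1; apply: (le_trans h1); rewrite ler_wpM2l ?theta_ge0 ?(ltW step_gt0)//.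
exact: Omega_le.
Qed.

Lemma trajectory_node i : (i <= N)%N -> tn i <= t -> Om i (x (tn i)).
Proof.
elim: i => [_ _|i IH iN it]; first by rewrite node0.
have ii : tn i <= tn i.+1 by exact: node_le.
have Oi := IH (ltnW iN) (le_trans ii it).
have sE : tn i.+1 = tn i + 1 * h by rewrite mul1r nodeS.
have [v Uv hv] := trajectory_step iN Oi ii it ler01 (lexx _) sE.
rewrite !mul1r subrr mul0r addr0 in hv.
have := constant_control_Omega iN Oi Uv hv.
by rewrite -[_ - _ - _]addrA -opprD subrKC.
Qed.

(** The residual [d] of the convex combination is of the order of [l] times the
    two radii.  Divided by [l] it splits into a part absorbed by the radius of
    [Om i.+1] and a part absorbed by the inflation in [Gamma]. *)
Lemma trajectory_Gamma i l : (i < N)%N -> 0 <= l -> l <= 1 ->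
  t = tn i + l * h ->
  Gamma NX NU t0 tf B X0 U MA MdA MB MdB phit theta N i.+1 (x t).
Proof.
move=> iN l0 l1 tE.
have hE : tn i.+1 - tn i = h by rewrite nodeS addrAC subrr add0r.
have it : tn i <= t by rewrite tE lerDl mulr_ge0// (ltW step_gt0).
have Oi := trajectory_node (ltnW iN) it.
have [v Uv hv] := trajectory_step iN Oi it (lexx t) l0 l1 tE.
have := phi_chord (x (tn i)) (node_ge i) (node_tf (ltnW iN))
  (node_le (leqnSn i)) (node_tf iN) l0 l1.
rewrite hE -tE => chord.
set p := x (tn i) in Oi hv chord *.
set P1 := phi (tn i.+1) (tn i) *m p in chord *.
set Pt := phi t (tn i) *m p in hv chord *.
set b := h *: (B (tn i.+1) *m v).
set delta := Defs.beta rho MdB h + Defs.gamma MA MdA h * set_norm NX (Om i).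
have beta0 : 0 <= Defs.beta rho MdB h.
  apply: mulr_ge0 rhoU_ge0; apply: mulr_ge0 MdB0.
  exact: exprn_ge0 (ltW step_gt0).
have gamma0 : 0 <= Defs.gamma MA MdA h.
  apply: mulr_ge0 (rfun_ge0 _ _) _; apply: addr_ge0 => //.
  by rewrite divr_ge0 ?exprn_ge0 ?(ltW MA0).
have delta0 : 0 <= delta.
  exact: addr_ge0 beta0 (mulr_ge0 gamma0 (set_norm_ge0 hX _)).
pose d := x t - ((1 - l) *: p + l *: (P1 + b)).
have hd : NX d <= l * (alpha rho MA MB MdB h + delta).
  have -> : d = (x t - Pt - (l * h) *: (B (tn i.+1) *m v)) +
      (Pt - ((1 - l) *: p + l *: P1)).
    by rewrite /d /b scalerDr scalerA; apply/matrixP => r c; rewrite !mxE; ring.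
  apply: (le_trans (nrmD hX _ _)); apply: (le_trans (lerD hv chord)).
  rewrite -mulrDr ler_wpM2l// -addrA lerD2l; apply: lerD.
    by rewrite ler_piMl// lerBlDr lerDl.
  by rewrite ler_wpM2l// Omega_le.
(* for [l = 0] the residual vanishes and the inverse is 0 by convention *)
have dl : d = l *: (l^-1 *: d).
  have [l0'|l0'] := eqVneq l 0; last by rewrite scalerA divff// scale1r.
  rewrite l0' scale0r; apply/(nrm0_eq0 hX)/le_anti; rewrite (nrm_ge0 hX) andbT.
  by rewrite l0' mul0r in hd.
have : NX (l^-1 *: d) <= alpha rho MA MB MdB h + delta.
  rewrite (nrmZp hX) ?invr_ge0//.
  have [l0'|l0'] := eqVneq l 0.
    by rewrite l0' invr0 mul0r addr_ge0// alpha_ge0.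
  by rewrite mulrC ler_pdivrMr 1?mulrC// lt_neqAle eq_sym l0'.
move=> /(nrm_split hX alpha_ge0 delta0)[e1 [e2 [de he1 he2]]].
(* the second point of the combination belongs to the inflated [Om i.+1] *)
have -> : x t = l *: ((P1 + b + e1) + e2) + (1 - l) *: p.
  rewrite -(addrA _ e1) -de scalerDr -dl /d.
  by apply/matrixP => r c; rewrite !mxE; ring.
apply: conv_hull_segment => //; last by left.
right; exists (P1 + b + e1).
  exact: constant_control_Omega.
by exists e2 => //; exact/(scale_ballP hX _ delta0).
Qed.

End trajectory.

Lemma reach_tube_sub : reach_tube A B X0 U t0 t0 tf `<=`
  Rhat NX NU t0 tf B X0 U MA MdA MB MdB phit theta N.
Proof.
move=> z [t] /=; rewrite in_itv/= => /andP[tt0 ttf].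
move=> [x0 [u [x [X0x _ uU [xac xae xt0] ->]]]].
have x0' : X0 (x t0) by rewrite xt0.
have exi : exists i, (0 < i)%N && (t <= tn i) by exists N; rewrite N_gt0 nodeN.
(* the first node not before [t], of positive index so that a step precedes it *)
case: (ex_minnP exi) => -[//|i] /= ti imin.
have iN : (i < N)%N by apply: imin; rewrite N_gt0 nodeN.
have it : tn i <= t.
  case: i imin {ti iN} => [_|i imin]; first by rewrite node0.
  by rewrite leNgt; apply/negP => /ltW ti; have := imin i.+1 ti; rewrite ltnn.
exists i.+1 => //.
pose l := (t - tn i) / h.
have hne : h != 0 by rewrite gt_eqF// step_gt0.
apply: (@trajectory_Gamma t x u ttf x0' xac xae uU i l) => //.
- by rewrite divr_ge0 ?subr_ge0// ltW// step_gt0.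
- by rewrite ler_pdivrMr ?step_gt0// mul1r lerBlDr addrC -nodeS.
- by rewrite divfK// subrKC.
Qed.

(** * Rate of convergence *)

Section rates.
Hypothesis theta_le : theta h <= Ct * h ^+ 2.
Hypothesis short : expR (MA * h) <= 3 / 2.

Lemma h_le_L : h <= L.
Proof.
by rewrite /h /Defs.step -/L ler_pdivrMr ?ltr0n// ler_peMr ?ler1n.
Qed.

Lemma node_offset_le i : (i <= N)%N -> i%:R * h <= L.
Proof. by move=> /node_tf; rewrite /tn /node -/h /L lerBrDl. Qed.

Lemma sqr_step_le : h ^+ 2 <= L * h.
Proof. by rewrite expr2 ler_wpM2r ?h_le_L// ltW// step_gt0. Qed.

Lemma exp_step_le : expR (h * MA) <= EL.
Proof. by rewrite ler_expR ler_wpM2r ?h_le_L// ltW. Qed.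

Lemma exp_step_sub1 : expR (MA * h) - 1 <= MA * EL * h.
Proof.
have h0 := ltW step_gt0.
have := expR_sub1_le (mulr_ge0 MA_ge0 h0).
have := ler_wpM2l (mulr_ge0 MA_ge0 h0) exp_step_le; rewrite (mulrC h MA); lra.
Qed.

Lemma rfun_step_le : rfun MA h <= MA ^+ 2 * EL * h ^+ 2.
Proof.
have h0 := ltW step_gt0.
apply: (le_trans (rfun_le_sqr (ltW MA0) h0)).
have := ler_wpM2l (sqr_ge0 (h * MA)) exp_step_le; rewrite exprMn; lra.
Qed.

Lemma alpha_le : alpha rho MA MB MdB h <= Ca * h ^+ 2.
Proof.
have q0 : 0 <= rho * ((MdB + MA * MB) / MA ^+ 2).
  rewrite mulr_ge0 ?rhoU_ge0// divr_ge0 ?exprn_ge0 ?(ltW MA0)//.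
  by rewrite addr_ge0 ?mulr_ge0 ?(ltW MA0).
rewrite /alpha -mulrA; apply: (le_trans (ler_wpM2r q0 rfun_step_le)).
by rewrite le_eqVlt; apply/orP; left; apply/eqP; rewrite /Ca; field;
  exact: lt0r_neq0.
Qed.

Lemma theta_step_ge0 : 0 <= theta h.
Proof. exact: theta_ge0 (ltW step_gt0). Qed.

Lemma theta_step_lin : theta h <= Ct * L * h.
Proof.
by apply: (le_trans theta_le); rewrite -mulrA ler_wpM2l// sqr_step_le.
Qed.

Lemma B_step_le i v : (i < N)%N -> U v ->
  NX (h *: (B (tn i.+1) *m v)) <= h * (MB * rho).
Proof.
move=> iN Uv; rewrite (nrmZp hX) ?(ltW step_gt0)//.
rewrite ler_wpM2l ?(ltW step_gt0)//.
apply: (le_trans (B_le _ (node_ge _) (node_tf iN))).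
by rewrite ler_wpM2l// U_le.
Qed.

Lemma phi_step_le i q : (i < N)%N ->
  NX (phi (tn i.+1) (tn i) *m q) <= expR (MA * h) * NX q.
Proof.
move=> iN.
have := phi_le q (node_ge i) (node_tf (ltnW iN)) (node_le (leqnSn i)) (node_tf iN).
by have -> : tn i.+1 - tn i = h by rewrite nodeS addrAC subrr add0r.
Qed.

Lemma phit_step_le i q : (i < N)%N ->
  NX ((phi (tn i.+1) (tn i) - phit (tn i.+1) (tn i)) *m q) <= theta h * NX q.
Proof.
move=> iN.
have := phit_le q (node_ge i) (node_le (leqnSn i)) (node_tf iN).
by have -> : tn i.+1 - tn i = h by rewrite nodeS addrAC subrr add0r.
Qed.

(** One step multiplies the radius by at most [1 + C1 * h] and adds [C2 * h]; the
    number of steps is at most [L / h]. *)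
Lemma Omega_uniform i : (i <= N)%N -> set_norm NX (Om i) <= Rm.
Proof.
move=> iN; have h0 := ltW step_gt0.
pose a i := set_norm NX (Om i).
have a0 j : 0 <= a j by exact: (set_norm_ge0 hX).
have rec j : (j < N)%N -> a j.+1 <= (1 + C1 * h) * a j + C2 * h.
  move=> jN; apply: set_norm_le; first exact: Omega_ne.
  move=> z /OmegaSP[y [v [Oy Uv hz]]].
  set P := phit _ _ in hz; set b := h *: _ in hz.
  have -> : z = (z - (P *m y + b)) + b + phi (tn j.+1) (tn j) *m y -
    (phi (tn j.+1) (tn j) - P) *m y.
    by rewrite mulmxBl; apply/matrixP => r c; rewrite !mxE; ring.
  have ya := Omega_le Oy; rewrite -/(a j) in ya.
  have k1 := B_step_le jN Uv; have k2 := phi_step_le y jN.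
  have k3 := phit_step_le y jN; rewrite -/b in k1; rewrite -/P in k3.
  have k4 := ler_wpM2l (expR_ge0 (MA * h)) ya.
  have k5 := ler_wpM2l theta_step_ge0 ya.
  have k6 := ler_wpM2r (a0 j) exp_step_sub1.
  have k7 := ler_wpM2r (a0 j) theta_step_lin.
  have k8 : Ca * h ^+ 2 <= Ca * L * h.
    by rewrite -mulrA ler_wpM2l ?Ca_ge0// sqr_step_le.
  have k9 := alpha_le; rewrite /err -/(a j) in hz.
  apply: (le_trans (nrmB hX _ _)); apply: (le_trans (lerD (nrmD hX _ _) k3)).
  have k10 := nrmD hX (z - (P *m y + b)) b.
  rewrite /C1 /C2; lra.
apply: (le_trans (discrete_gronwall C1_ge0 C2_ge0 h0 (a0 0%N) rec iN)).
have iL := node_offset_le iN.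
rewrite /Rm; apply: ler_pM.
- exact: expR_ge0.
- by rewrite addr_ge0 ?mulr_ge0 ?C2_ge0.
- by rewrite ler_expR ler_wpM2l ?C1_ge0.
- by rewrite lerD2l ler_wpM2l ?C2_ge0.
Qed.

Lemma err_le i : (i <= N)%N -> err i <= C3 * h ^+ 2.
Proof.
move=> iN; rewrite /err /C3 mulrDl; apply: lerD; first exact: alpha_le.
rewrite mulrAC; apply: ler_pM => //; first exact: theta_step_ge0.
  exact: (set_norm_ge0 hX).
exact: Omega_uniform.
Qed.

(** A point of [Om i.+1] comes with a point of [Om i] and a control value; the
    trajectory following the former is prolonged with this value held constant.
    The error is amplified by [phi] and increased by twice the radius [err i]: once
    for the ball in the definition of [Om i.+1], once for the replacement of
    [phi] and of the effect of the control by their approximations.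
    Lipschitz continuity is carried along because it is preserved by
    concatenation and implies absolute continuity. *)
Lemma Omega_tracking (e : nat -> R) : 0 <= e 0%N ->
  (forall i, e i.+1 = (1 + C1 * h) * e i + 2 * C3 * h * h) ->
  forall i z, (i <= N)%N -> Om i z -> exists x u,
    [/\ X0 (x t0), lebesgue_measurable_fun `[t0, tn i] u,
        forall s, s \in `[t0, tn i] -> U (u s),
        {ae lebesgue_measure, forall s : R, s \in `[t0, tn i] ->
          is_derive (s : R^o) (1 : R^o) x (A s *m x s + B s *m u s)} &
        (exists C, forall s t, t0 <= s -> s <= t -> t <= tn i ->
          `|x t - x s| <= C * (t - s)) /\ NX (z - x (tn i)) <= e i].
Proof.
move=> e0 eS; have h0 := ltW step_gt0; elim=> [|i IH] z iN Oz.
  have [v Uv] := U_ne; exists (fun=> z), (fun=> v); rewrite node0; split => //.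
  - exact: measurable_constant.
  - apply: ae_imp (ae_neq t0) => s st0; rewrite in_itv/= => /le_anti st.
    by rewrite st eqxx in st0.
  - split; last by rewrite subrr (nrm0 hX).
    by exists 0 => s t _ _ _; rewrite subrr normr0 mul0r.
have [y [v [Oy Uv hz]]] := (OmegaSP i z).1 Oz.
have [x1 [u1 [x10 mu1 u1U ae1 [lip1 near1]]]] := IH y (ltnW iN) Oy.
have ii : tn i <= tn i.+1 by exact: node_le.
have hE : tn i.+1 - tn i = h by rewrite nodeS addrAC subrr add0r.
have shorti : expR (MA * (tn i.+1 - tn i)) <= 3 / 2 by rewrite hE.
have [x2 [x2p ae2 lip2]] := constant_control_solution (node_ge i) ii
  (node_tf iN) shorti (x1 (tn i)) v.
pose x s := if s <= tn i then x1 s else x2 s.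
pose u s := if s <= tn i then u1 s else v.
have xend : x (tn i.+1) = x2 (tn i.+1).
  by rewrite /x nodeS gerDl leNgt step_gt0.
exists x, u; split.
- by rewrite /x node_ge.
- by apply: measurable_concat => //; exact: node_ge.
- move=> s; rewrite in_itv/= /u => /andP[t0s si]; case: leP => // sti.
  by apply: u1U; rewrite in_itv/= t0s.
- apply: ae_imp2 (ae_neq (tn i)) (ae_and ae1 ae2) => s sne [d1 d2].
  rewrite in_itv/= => /andP[t0s si].
  have [sti|ist] := leP s (tn i).
    have sti' : s < tn i by rewrite lt_neqAle sne.
    have ds : 0 < tn i - s by rewrite subr_gt0.
    rewrite /x /u sti; apply: (is_derive_near ds) (d1 _); last first.
      by rewrite in_itv/= t0s.
    move=> r; rewrite ltr_norml => /andP[_ r2]; case: leP => // r3; exfalso; lra.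
  have ds : 0 < s - tn i by rewrite subr_gt0.
  rewrite /x /u leNgt ist/=; apply: (is_derive_near ds) (d2 _); last first.
    by rewrite in_itv/= si ltW.
  move=> r; rewrite ltr_norml => /andP[r2 _]; case: leP => // r3; exfalso; lra.
split; first exact: lip_concat lip1 lip2.
have [C lipC] := lip2.
(* [control_step] at the end of the step, with the one-point control set [v] *)
have [_ -> hv] : exists2 v', [set v] v' & NX (x2 (tn i.+1) -
    phi (tn i.+1) (tn i) *m x2 (tn i) - (tn i.+1 - tn i) *: (B (tn i.+1) *m v')) <=
    1 * (alpha rho MA MB MdB (tn i.+1 - tn i) +
      (1 - 1) * Defs.beta rho MdB (tn i.+1 - tn i)).
  apply: (@control_step (tn i) (tn i.+1) x2 (fun=> v) [set v] rho) => //.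
  - exact: node_ge.
  - exact: node_tf.
  - exact: ac_lip lipC.
  - by move=> _ ->; exact: U_le.
  - exact: node_tf.
  - by rewrite mul1r.
  - exact: compact_set1.
  - by move=> a b c _ _ -> ->; rewrite -scalerDl subrKC scale1r.
rewrite hE subrr mul0r addr0 mul1r x2p in hv.
rewrite xend; set P := phit _ _ in hz; set b := h *: _ in hz hv.
set Q := phi _ _ in hv; set p := x1 _ in hv near1.
have -> : z - x2 (tn i.+1) = (z - (P *m y + b)) - (Q - P) *m y + Q *m (y - p) -
    (x2 (tn i.+1) - Q *m p - b).
  by rewrite mulmxBl mulmxBr; apply/matrixP => r c; rewrite !mxE; ring.
have k1 := phit_step_le y iN; have k2 := phi_step_le (y - p) iN.
have k3 := ler_wpM2l theta_step_ge0 (Omega_le Oy).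
have k4 := ler_wpM2l (expR_ge0 (MA * h)) near1.
have ei : 0 <= e i by apply: le_trans near1; exact: (nrm_ge0 hX).
have k5 := ler_wpM2r ei exp_step_sub1.
have k6 : 0 <= 2 * Ct * L * h * e i.
  by rewrite !mulr_ge0 ?Ct_ge0 ?(ltW L_gt0).
have k7 := err_le (ltnW iN).
apply: (le_trans (nrmB hX _ _)); apply: (le_trans (lerD (nrmD hX _ _) hv)).
have k8 := nrmB hX (z - (P *m y + b)) ((Q - P) *m y).
rewrite eS; rewrite /err in hz k7; rewrite -/Q -/P in k1 k2; rewrite /C1; lra.
Qed.

Lemma Omega_near_reach i z : (i <= N)%N -> Om i z ->
  exists2 y, reach A B X0 U t0 (tn i) y & NX (z - y) <= C4 * h.
Proof.
move=> iN Oz; have h0 := ltW step_gt0.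
pose e := fix e i : R :=
  if i is j.+1 then (1 + C1 * h) * e j + 2 * C3 * h * h else 0.
have [x [u [x0 mu uU xae [[C xlip] near]]]] :=
  @Omega_tracking e (lexx _) (fun=> erefl) i z iN Oz.
exists (x (tn i)).
  exists (x t0), u, x; split => //; split => //.
  exact: ac_lip xlip.
apply: (le_trans near).
have d0 : 0 <= 2 * C3 * h by rewrite !mulr_ge0 ?C3_ge0.
have rec j : (j < N)%N -> e j.+1 <= (1 + C1 * h) * e j + 2 * C3 * h * h by [].
apply: (le_trans (discrete_gronwall C1_ge0 d0 h0 (lexx 0) rec iN)).
have iL := node_offset_le iN.
rewrite add0r (_ : C4 * h = expR (C1 * L) * (2 * C3 * h * L)); last first.
  by rewrite /C4; ring.
apply: ler_pM.
- exact: expR_ge0.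
- by rewrite !mulr_ge0 ?C3_ge0.
- by rewrite ler_expR ler_wpM2l ?C1_ge0.
- by rewrite ler_wpM2l.
Qed.

Lemma Omega_step_near i z : (i < N)%N -> Om i.+1 z ->
  exists2 y, Om i y & NX (z - y) <= C5 * h.
Proof.
move=> iN /OmegaSP[y [v [Oy Uv hz]]]; exists y => //.
set P := phit _ _ in hz; set b := h *: _ in hz.
set Q := phi (tn i.+1) (tn i).
have -> : z - y = (z - (P *m y + b)) - (Q - P) *m y + b + (Q *m y - y).
  by rewrite mulmxBl; apply/matrixP => r c; rewrite !mxE; ring.
have yR : NX y <= Rm.
  exact: le_trans (Omega_le Oy) (Omega_uniform (ltnW iN)).
have k1 := phit_step_le y iN; have k2 := B_step_le iN Uv.
rewrite -/Q -/P in k1; rewrite -/b in k2.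
have k3 := ler_wpM2l theta_step_ge0 yR.
have k4 := ler_wpM2r Rm_ge0 theta_step_lin.
have k5 : NX (Q *m y - y) <= (expR (MA * h) - 1) * NX y.
  have := phi_incr y (node_ge i) (node_tf (ltnW iN)) (lexx _)
    (node_le (leqnSn i)) (node_tf iN).
  rewrite (phi_start _ (node_ge i) (node_tf (ltnW iN))) subrr mulr0 expR0.
  by have -> : tn i.+1 - tn i = h by rewrite nodeS addrAC subrr add0r.
have k6 : (expR (MA * h) - 1) * NX y <= MA * EL * h * Rm.
  apply: ler_pM => //; [|exact: (nrm_ge0 hX)|exact: exp_step_sub1].
  by rewrite subr_ge0 -expR0 ler_expR mulr_ge0 ?(ltW MA0)// (ltW step_gt0).
have k7 := err_le (ltnW iN).
have k8 : C3 * h ^+ 2 <= C3 * L * h.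
  by rewrite -mulrA ler_wpM2l ?C3_ge0// sqr_step_le.
apply: (le_trans (nrmD hX _ _)); apply: (le_trans (lerD (nrmD hX _ _) k5)).
have k9 := nrmB hX (z - (P *m y + b)) ((Q - P) *m y).
rewrite /C5; lra.
Qed.

(** The points at distance at most [C6 * h] from the convex set [Om i] form a
    convex set which contains both generators of the hull. *)
Lemma Gamma_near_Omega i z : (i < N)%N ->
  Gamma NX NU t0 tf B X0 U MA MdA MB MdB phit theta N i.+1 z ->
  exists2 y, Om i y & NX (z - y) <= C6 * h.
Proof.
move=> iN; have h0 := ltW step_gt0.
move: z; apply: (@conv_hull_min _ _ _
  [set z | exists2 y, Om i y & NX (z - y) <= C6 * h]).
  move=> z z' a a0 a1 [y Oy hy] [y' Oy' hy'].
  have a2 : 0 <= 1 - a by rewrite subr_ge0.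
  exists (a *: y + (1 - a) *: y'); first exact: Omega_convex.
  rewrite opprD addrACA -!scalerBr; apply: (le_trans (nrmD hX _ _)).
  rewrite !(nrmZp hX)//.
  have := ler_wpM2l a0 hy; have := ler_wpM2l a2 hy'; lra.
have b0 : 0 <= Defs.beta rho MdB h.
  by apply: mulr_ge0 rhoU_ge0; apply: mulr_ge0 MdB0; exact: exprn_ge0.
have g1 : 0 <= 1 + MdA / MA ^+ 2.
  by rewrite addr_ge0 ?divr_ge0 ?exprn_ge0 ?(ltW MA0).
have g0 : 0 <= Defs.gamma MA MdA h.
  exact: mulr_ge0 (rfun_ge0 _ _) g1.
have c50 : 0 <= C5 by exact: C5_ge0.
have c6 : Defs.beta rho MdB h + Defs.gamma MA MdA h * Rm <= (C6 - C5) * h.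
  have k1 : Defs.beta rho MdB h <= L * MdB * rho * h.
    rewrite /Defs.beta.
    have := ler_wpM2r (mulr_ge0 MdB0 rhoU_ge0) sqr_step_le; lra.
  have k2 : Defs.gamma MA MdA h * Rm <=
      L * MA ^+ 2 * EL * (1 + MdA / MA ^+ 2) * Rm * h.
    have j1 := ler_wpM2r (mulr_ge0 g1 Rm_ge0) rfun_step_le.
    have c0 : 0 <= MA ^+ 2 * EL * ((1 + MdA / MA ^+ 2) * Rm).
      apply: mulr_ge0 (mulr_ge0 g1 Rm_ge0); apply: mulr_ge0 EL_ge0.
      exact: exprn_ge0.
    have j2 := ler_wpM2l c0 sqr_step_le.
    rewrite /Defs.gamma; lra.
  rewrite /C6; lra.
have c56 : C5 * h <= C6 * h.
  have := addr_ge0 b0 (mulr_ge0 g0 Rm_ge0); lra.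
move=> z [/= Oz|[q Oq [e he <-]]].
  exists z => //; rewrite subrr (nrm0 hX); apply: le_trans c56.
  exact: mulr_ge0.
have [y Oy hy] := Omega_step_near iN Oq.
exists y => //.
have r0 : 0 <= Defs.beta rho MdB h + Defs.gamma MA MdA h * set_norm NX (Om i).
  exact: addr_ge0 b0 (mulr_ge0 g0 (set_norm_ge0 hX _)).
have {}he := (scale_ballP hX _ r0).1 he.
have k1 := ler_wpM2l g0 (Omega_uniform (ltnW iN)).
rewrite addrAC; apply: (le_trans (nrmD hX _ _)); lra.
Qed.

Lemma Rhat_near z :
  Rhat NX NU t0 tf B X0 U MA MdA MB MdB phit theta N z ->
  exists2 y, reach_tube A B X0 U t0 t0 tf y & NX (z - y) <= (C4 + C6) * h.
Proof.
move=> [[|i] /= iN]; first by [].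
move=> /(Gamma_near_Omega iN)[w Ow hw].
have [y Ry hy] := Omega_near_reach (ltnW iN) Ow.
exists y.
  by exists (tn i) => //=; rewrite in_itv/= node_ge node_tf// ltnW.
have := nrm_tri hX w z y; lra.
Qed.

Lemma hausdorff_le :
  0 <= hausdorff NX (reach_tube A B X0 U t0 t0 tf)
    (Rhat NX NU t0 tf B X0 U MA MdA MB MdB phit theta N) <= (C4 + C6 + 1) * h.
Proof.
set S := reach_tube _ _ _ _ _ _ _; set T := Rhat _ _ _ _ _ _ _ _ _ _ _ _ _ _.
pose E := [set e | [/\ 0 < e, S `<=` set_add T (set_scale e (unit_ball NX))
  & T `<=` set_add S (set_scale e (unit_ball NX))]].
have e0 : 0 < (C4 + C6 + 1) * h.
  by rewrite mulr_gt0 ?step_gt0// ltr_wpDl// addr_ge0 ?C4_ge0 ?C6_ge0.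
have Ee : E ((C4 + C6 + 1) * h).
  split => //.
    move=> z Sz; exists z; first exact: reach_tube_sub.
    exists 0; last by rewrite addr0.
    by apply/(scale_ballP hX _ (ltW e0)); rewrite (nrm0 hX) ltW.
  move=> z /Rhat_near[y Sy hy]; exists y => //; exists (z - y).
    apply/(scale_ballP hX _ (ltW e0)); apply: (le_trans hy).
    by rewrite ler_wpM2r ?lerDl// ltW// step_gt0.
  by rewrite subrKC.
have lb : lbound E 0 by move=> e [/ltW].
rewrite /hausdorff -/E; apply/andP; split.
  by apply: lb_le_inf => //; exists ((C4 + C6 + 1) * h).
by apply: ge_inf => //; exists 0.
Qed.

End rates.

End fixed_mesh.

Lemma hausdorff_rate : exists C, 0 < C /\ forall N, (0 < N)%N ->
  let h := Defs.step t0 tf N in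
  theta h <= Ct * h ^+ 2 -> expR (MA * h) <= 3 / 2 ->
  0 <= hausdorff NX (reach_tube A B X0 U t0 t0 tf)
    (Rhat NX NU t0 tf B X0 U MA MdA MB MdB phit theta N) <= C * h.
Proof.
exists (C4 + C6 + 1); split; first by rewrite ltr_wpDl// addr_ge0.
by move=> N N0 h hth hs; exact: hausdorff_le.
Qed.

End over_approximation.

End linear_system.

(** * The convergence theorem *)

Lemma short_steps (R : realType) (L M d : R) : 0 <= L -> 0 < M -> 0 < d ->
  \forall N \near \oo, L / N%:R < d /\ expR (M * (L / N%:R)) <= 3 / 2.
Proof.
move=> L0 M0 d0.
have c0 : 0 < 2 * M * expR M by rewrite !mulr_gt0 ?expR_gt0.
(* below 1 / (2 M expR M) the bound [expR z - 1 <= z expR z] gives the claim *)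
pose d' := Num.min d (Num.min 1 (2 * M * expR M)^-1).
have d'0 : 0 < d' by rewrite !lt_min d0 ltr01 invr_gt0.
near=> N.
have N0 : (0 < N)%N by near: N; exact: nbhs_infty_gt.
have hd' : L / N%:R < d'.
  rewrite ltr_pdivrMr ?ltr0n// -ltr_pdivrMl//.
  by near: N; exact: nbhs_infty_gtr.
have h0 : 0 <= L / N%:R by rewrite divr_ge0.
move: hd' h0; rewrite !lt_min => /and3P[hd h1 h2]; move: (L / N%:R) hd h1 h2.
move=> h hd h1 h2 h0; split => //.
have e1 := expR_sub1_le (mulr_ge0 (ltW M0) h0).
have e2 : expR (M * h) <= expR M by rewrite ler_expR ger_pMr// ltW.
have e3 := ler_wpM2l (mulr_ge0 (ltW M0) h0) e2.
have e4 : 2 * M * expR M * h <= 1.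
  by rewrite mulrC -ler_pdivlMr// div1r ltW.
lra.
Unshelve. all: by end_near. Qed.

Theorem mainTheorem2 (R : realType) (n m : nat) (n_gt0 : (0 < n)%N)
    (m_gt0 : (0 < m)%N)
    (normX : 'cV[R]_n -> R) (normU : 'cV[R]_m -> R)
    (normX_norm : is_norm normX) (normU_norm : is_norm normU)
    (t0 tf : R) (t0_lt_tf : t0 < tf)
    (X0 : set 'cV[R]_n) (U : set 'cV[R]_m)
    (X0_nonempty : X0 !=set0) (X0_compact : compact X0)
    (X0_convex : @convex_set R 'cV[R]_n X0)
    (U_nonempty : U !=set0) (U_compact : compact U)
    (U_convex : @convex_set R 'cV[R]_m U)
    (A : R -> 'M[R]_n) (B : R -> 'M[R]_(n, m))
    (A_C1 : C1_on t0 tf A) (B_C1 : C1_on t0 tf B)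
    (MA MdA MB MdB : R) (MA_gt0 : 0 < MA)
    (A_bound : forall t, t \in `[t0, tf] -> opnorm normX normX (A t) <= MA)
    (dA_bound : forall t, t \in `[t0, tf] ->
       opnorm normX normX (derive_within `[t0, tf] A t) <= MdA)
    (B_bound : forall t, t \in `[t0, tf] -> opnorm normU normX (B t) <= MB)
    (dB_bound : forall t, t \in `[t0, tf] ->
       opnorm normU normX (derive_within `[t0, tf] B t) <= MdB)
    (phi : R -> R -> 'M[R]_n)
    (phi_transition : is_transition_matrix A B t0 tf phi)
    (phit : R -> R -> 'M[R]_n) (theta : R -> R)
    (theta_ge0 : forall h, 0 <= h -> 0 <= theta h)
    (theta_mono : forall h k, 0 <= h -> h <= k -> theta h <= theta k)
    (phit_approx : forall t s, t0 <= s -> s <= t -> t <= tf ->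
       opnorm normX normX (phi t s - phit t s) <= theta (t - s))
    (theta_O : theta =O_ (0^'+) (fun h : R => h ^+ 2)) :
  (forall N : nat, (0 < N)%N ->
     reach_tube A B X0 U t0 t0 tf `<=`
     Rhat normX normU t0 tf B X0 U MA MdA MB MdB phit theta N) /\
  (fun N : nat =>
     hausdorff normX (reach_tube A B X0 U t0 t0 tf)
       (Rhat normX normU t0 tf B X0 U MA MdA MB MdB phit theta N))
    =O_\oo (fun N : nat => N%:R^-1 : R).
Proof.
have hX := normX_norm; have hU := normU_norm.
have t0in : t0 \in `[t0, tf] by rewrite in_itv/= lexx ltW.
have tin t : t0 <= t -> t <= tf -> t \in `[t0, tf].
  by move=> h1 h2; rewrite in_itv/= h1.
have MdA0 : 0 <= MdA := le_trans (opnorm_ge0 hX hX _) (dA_bound t0 t0in).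
have MB0 : 0 <= MB := le_trans (opnorm_ge0 hX hU _) (B_bound t0 t0in).
have MdB0 : 0 <= MdB := le_trans (opnorm_ge0 hX hU _) (dB_bound t0 t0in).
have A_le t x : t0 <= t -> t <= tf -> normX (A t *m x) <= MA * normX x.
  by move=> h1 h2; apply: opnorm_bound => //; apply: A_bound; exact: tin.
have B_le t x : t0 <= t -> t <= tf -> normX (B t *m x) <= MB * normU x.
  by move=> h1 h2; apply: opnorm_bound => //; apply: B_bound; exact: tin.
have A_lip := C1_lip hX hX A_C1 dA_bound.
have B_lip := C1_lip hX hU B_C1 dB_bound.
have phit_le t s x : t0 <= s -> s <= t -> t <= tf ->
    normX ((phi t s - phit t s) *m x) <= theta (t - s) * normX x.
  by move=> h1 h2 h3; apply: opnorm_bound => //; exact: phit_approx.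
move/convexP : X0_convex => X0c; move/convexP : U_convex => Uc.
split=> [N N0|].
  exact: (reach_tube_sub hX hU MA_gt0 MdA0 MB0 MdB0 A_le A_lip B_le B_lip
    phi_transition).
have /eqO_exP[Ct Ct0] := theta_O.
rewrite near_withinE => /nbhs_ballP[d /= d0 hd].
have [C [C0 hC]] := hausdorff_rate hX hU MA_gt0 MdA0 MB0 MdB0 A_le A_lip B_le B_lip
  phi_transition t0_lt_tf X0_nonempty X0_compact X0c U_nonempty U_compact Uc
  theta_ge0 phit_le (ltW Ct0).
apply/eqO_exP.
have L0 : 0 < tf - t0 by rewrite subr_gt0.
exists (C * (tf - t0)); first exact: mulr_gt0.
have sN := short_steps (ltW L0) MA_gt0 d0.
near=> N.
have N0 : (0 < N)%N by near: N; exact: nbhs_infty_gt.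
have [sd sh] : step t0 tf N < d /\ expR (MA * step t0 tf N) <= 3 / 2.
  by near: N.
have s0 : 0 < step t0 tf N by rewrite divr_gt0// ltr0n.
have th : theta (step t0 tf N) <= Ct * step t0 tf N ^+ 2.
  have sd' : `|0 - step t0 tf N| < d by rewrite sub0r normrN gtr0_norm.
  have := hd _ sd' s0.
  by rewrite (ger0_norm (sqr_ge0 _)); apply: le_trans; exact: ler_norm.
have /andP[h1 h2] := hC N N0 th sh.
rewrite ger0_norm// ger0_norm ?invr_ge0//; apply: (le_trans h2).
by rewrite /step mulrA.
Unshelve. all: by end_near. Qed.
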